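(* Let $A,B,C$ be any strings, and let $|A|=M$, $|B|=N$, $|\mathit{RLE}(A)|=m$ and $|\mathit{RLE}(B)|=n$. If $|\mathit{RLE}(C)|>1$, the length of an STR-IC-LCS of $A,B,C$ can be computed in $O(mN+nM)$ time.
   Context: Strings are over a finite alphabet $\Sigma$. A string $Z$ is a subsequence of $A$ if $Z$ can be obtained from $A$ by deleting zero or more characters. An STR-IC-LCS of $A,B,C$ is a longest string $Z$ that contains $C$ as a substring (contiguous) and is a subsequence of both $A$ and $B$; the task is to compute its length given $A,B,C$. The run-length encoding $\mathit{RLE}(A)$ of $A$ represents each maximal run of equal characters by the pair (character, run length); its size $|\mathit{RLE}(A)|$ is the number of maximal runs of $A$. Standing assumptions of the paper: $0<|C|\le\min\{M,N\}$. *)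

(* Defs.v *)
From mathcomp Require Import all_boot.

Set Implicit Arguments.
Unset Strict Implicit.
Unset Printing Implicit Defensive.

Section Strings.

Variable Sigma : eqType.
Implicit Types (x : Sigma) (s A B C Z : seq Sigma).

Fixpoint rle s : seq (Sigma * nat) :=
  if s is x :: s' then
    if rle s' is (y, k) :: r then
      if x == y then (y, k.+1) :: r else (x, 1) :: (y, k) :: r
    else [:: (x, 1)]
  else [::].

Definition str_ic_cs A B C Z : Prop :=
  [/\ infix C Z, subseq Z A & subseq Z B].

Definition str_ic_lcs A B C Z : Prop :=
  str_ic_cs A B C Z /\ forall Z', str_ic_cs A B C Z' -> size Z' <= size Z.

(* A feasible Z contains the nonempty string C, so the value 0 is free to
   signal that no feasible Z exists. *)
Definition str_ic_lcs_answer A B C (r : nat) : Prop :=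
  (exists2 Z, str_ic_lcs A B C Z & size Z = r) \/
  ((forall Z, ~ str_ic_cs A B C Z) /\ r = 0).

End Strings.

(* Unit-cost word RAM, presented as a structured imperative language.
   A program text mentions finitely many scalar registers and finitely many
   zero-initialised random-access arrays, both named by numerals; interleaving
   the arrays in one memory turns a program into a classical RAM program with
   constant-factor overhead.  Words are the natural numbers below a capacity W.
   There is no overflow: an expression with a value outside the words has no
   value, and a program that evaluates it does not halt. *)

Inductive binop := Add | Sub | Mul | Div | Mod | Eq | Lt.

Inductive expr :=
  | Cst of nat
  | Reg of nat
  | Get of nat & expr
  | Bin of binop & expr & expr.

Inductive cmd :=
  | Skip
  | Assign of nat & expr
  | Store of nat & expr & expr
  | Seq of cmd & cmd
  | If of expr & cmd & cmd
  | While of expr & cmd.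

Record state := State { reg : nat -> nat; arr : nat -> nat -> nat }.

(* Sub is truncated, and division by 0 gives 0. *)
Definition binop_eval (o : binop) (m n : nat) : nat :=
  match o with
  | Add => m + n
  | Sub => m - n
  | Mul => m * n
  | Div => m %/ n
  | Mod => m %% n
  | Eq => m == n
  | Lt => m < n
  end.

Definition word (W v : nat) : option nat := if v < W then Some v else None.

Fixpoint eval (W : nat) (s : state) (e : expr) : option nat :=
  match e with
  | Cst v => word W v
  | Reg x => Some (reg s x)
  | Get a e1 => omap (arr s a) (eval W s e1)
  | Bin o e1 e2 =>
      if (eval W s e1, eval W s e2) is (Some v1, Some v2)
      then word W (binop_eval o v1 v2) else None
  end.

Fixpoint cost (e : expr) : nat :=
  match e with
  | Cst _ | Reg _ => 1
  | Get _ e1 => (cost e1).+1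
  | Bin _ e1 e2 => (cost e1 + cost e2).+1
  end.

Definition update T (f : nat -> T) (x : nat) (v : T) : nat -> T :=
  fun y => if y == x then v else f y.

Definition set_reg (s : state) (x v : nat) : state :=
  State (update (reg s) x v) (arr s).

Definition set_arr (s : state) (a i v : nat) : state :=
  State (reg s) (update (arr s) a (update (arr s a) i v)).

(* [exec W c s t s'] : from state s, the command c halts in state s' after
   exactly t elementary steps. *)
Inductive exec (W : nat) : cmd -> state -> nat -> state -> Prop :=
  | ExecSkip s : exec W Skip s 1 s
  | ExecAssign s x e v :
      eval W s e = Some v ->
      exec W (Assign x e) s (cost e).+1 (set_reg s x v)
  | ExecStore s a e1 e2 i v :
      eval W s e1 = Some i -> eval W s e2 = Some v ->
      exec W (Store a e1 e2) s (cost e1 + cost e2).+1 (set_arr s a i v)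
  | ExecSeq s1 s2 s3 c1 c2 t1 t2 :
      exec W c1 s1 t1 s2 -> exec W c2 s2 t2 s3 ->
      exec W (Seq c1 c2) s1 (t1 + t2).+1 s3
  | ExecIf s s' e c1 c2 v t :
      eval W s e = Some v -> exec W (if v != 0 then c1 else c2) s t s' ->
      exec W (If e c1 c2) s (cost e + t).+1 s'
  | ExecWhileEnd s e c :
      eval W s e = Some 0 ->
      exec W (While e c) s (cost e).+1 s
  | ExecWhileStep s1 s2 s3 e c v t1 t2 :
      eval W s1 e = Some v -> v != 0 ->
      exec W c s1 t1 s2 -> exec W (While e c) s2 t2 s3 ->
      exec W (While e c) s1 (cost e + t1 + t2).+1 s3.

Section Encoding.

Variable Sigma : finType.

Definition code (s : seq Sigma) : seq nat := [seq val (enum_rank x) | x <- s].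

(* The strings are given uncompressed, character by character, in arrays
   0, 1, 2, with their lengths in registers 0, 1, 2. *)
Definition input (A B C : seq Sigma) : state :=
  State (nth 0 [:: size A; size B; size C])
        (fun a => nth 0 (nth [::] [:: code A; code B; code C] a)).

End Encoding.

Definition output (s : state) : nat := reg s 3.

(* A polynomial capacity amounts to words of O(log size) bits. *)
Definition capacity (k size : nat) : nat := size ^ k.

(* Main.v *)
Require Import Defs.
From mathcomp Require Import all_boot zify.

(* A feasible string is P ++ C ++ S.  Cut C after its first run, C = C1 ++ C2,
   so that the letters on both sides of the cut differ.  In an embedding of
   P ++ C into A the cut can be moved to the start u of a run of A
   (subseq_split_bd); matching C1 greedily to the left and C2 greedily to the
   right of u leaves the longest possible prefix for P and suffix for S.  So
   one candidate for each pair of a run of A and a run of B suffices, and its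
   value is |C| plus the LCS lengths of the two remaining prefixes and of the
   two remaining suffixes.
   The LCS table is only filled at cells (i, j) such that i or j is a run
   boundary, which are O(mN + nM) cells.  Any other entry, and each new entry,
   takes O(1): if the letters before i and j agree, go back diagonally to the
   border of the block of runs around (i, j), adding the number of steps;
   otherwise take the maximum of the entries at the left and at the top border.
   The greedy matchings of C1, at run boundaries of A, form a similar table
   with O(m|C|) entries; suffixes are handled by reversing the strings. *)

Set Implicit Arguments.
Unset Strict Implicit.
Unset Printing Implicit Defensive.

(** * Runs *)

Section Runs.

Variables (T : eqType) (x0 : T).
Implicit Types (s t : seq T) (x y : T).

(** Length of the leading run, 0 for the empty string. *)
Definition hrun s : nat := if s is x :: _ then find (predC1 x) s else 0.

(* Length of the run that ends at position [i], cut off at [i]. *)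
Definition rl s i : nat := hrun (rev (take i s)).

(** Positions are gaps: [i] lies just before letter [i]. Both ends count as boundaries, so the
    border cells of a table are always among the filled ones. *)
Definition bd s i : bool :=
  [|| i == 0, size s <= i | nth x0 s i != nth x0 s i.-1].

Lemma hrun_le s : hrun s <= size s.
Proof. by case: s => // x s; exact: find_size. Qed.

Lemma hrun_gt0 s : 0 < size s -> 0 < hrun s.
Proof. by case: s => // x s _; rewrite /= eqxx. Qed.

Lemma hrun1 x : hrun [:: x] = 1.
Proof. by rewrite /= eqxx. Qed.

Lemma hrun_cons2 x y s :
  hrun [:: x, y & s] = (hrun (y :: s) * (y == x)).+1.
Proof.
rewrite /= !eqxx /=; case: (eqVneq y x) => [->|_] /=; last by rewrite muln0.
by rewrite muln1.
Qed.

Lemma hrun_const s k : k < hrun s -> nth x0 s k = nth x0 s 0.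
Proof.
case: s => // x s lt_k; have /negbFE/eqP := before_find x0 lt_k.
done.
Qed.

Lemma hrun_max s : hrun s < size s -> nth x0 s (hrun s) != nth x0 s 0.
Proof. by case: s => // x s; rewrite -has_find => /(nth_find x0). Qed.

Lemma rl_le s i : rl s i <= i.
Proof.
by apply: leq_trans (hrun_le _) _; rewrite size_rev size_take_min geq_minl.
Qed.

Lemma rl_gt0 s i : 0 < i <= size s -> 0 < rl s i.
Proof.
by case/andP=> i0 le_i; apply: hrun_gt0; rewrite size_rev size_take_min; lia.
Qed.

Lemma nth_rev_take s i k :
  i <= size s -> k < i -> nth x0 (rev (take i s)) k = nth x0 s (i - k.+1).
Proof.
move=> le_i lt_k; have si : size (take i s) = i by rewrite size_take_min; lia.
by rewrite nth_rev ?si // nth_take //; lia.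
Qed.

Lemma rl_const s i k : i <= size s -> i - rl s i <= k < i ->
  nth x0 s k = nth x0 s i.-1.
Proof.
move=> le_i /andP [le_k lt_k].
have := @hrun_const (rev (take i s)) (i - k.+1).
rewrite !nth_rev_take; [|lia..].
have -> : i - (i - k.+1).+1 = k by lia.
by rewrite subn1; apply; rewrite -/(rl s i); lia.
Qed.

Lemma rl_max s i : i <= size s -> rl s i < i ->
  nth x0 s (i - rl s i).-1 != nth x0 s i.-1.
Proof.
move=> le_i lt_r.
have si : size (rev (take i s)) = i by rewrite size_rev size_take_min; lia.
have := @hrun_max (rev (take i s)); rewrite si -/(rl s i) => /(_ lt_r).
by rewrite !nth_rev_take ?subnS ?subn0 //; lia.
Qed.

Lemma rl_bd s i : i <= size s -> bd s (i - rl s i).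
Proof.
move=> le_i; rewrite /bd; case: (posnP (i - rl s i)) => [->//|r_lt].
have i0 : 0 < rl s i by apply: rl_gt0; lia.
by rewrite eq_sym (@rl_const s i (i - rl s i)) ?rl_max ?orbT //; lia.
Qed.

(** The recurrence that [rl_cmd] evaluates. At [i = 0] a letter is compared with itself, since
    [0.-1 = 0], but [rl s 0 = 0] makes the product vanish. *)
Lemma rlS s i : i < size s ->
  rl s i.+1 = (rl s i * (nth x0 s i == nth x0 s i.-1)).+1.
Proof.
move=> lt_i; rewrite /rl (take_nth x0 lt_i) rev_rcons.
case: i lt_i => [|i] lt_i; first by rewrite take0 hrun1.
by rewrite (take_nth x0 (ltnW lt_i)) rev_rcons hrun_cons2 eq_sym.
Qed.

(* The first run boundary after [i]. *)
Definition nextb s i : nat := i + hrun (drop i s).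

(** Run lengths of the reversed string measure what remains of a run to the right, so a precomputed
    array gives the next boundary in O(1). *)
Lemma nextb_rl_rev s i : i <= size s -> i + rl (rev s) (size s - i) = nextb s i.
Proof. by move=> le_i; rewrite /rl take_rev revK subKn. Qed.

Lemma nextb_le s i : i <= size s -> nextb s i <= size s.
Proof.
by move=> le_i; rewrite /nextb; have := hrun_le (drop i s); rewrite size_drop; lia.
Qed.

Lemma nextb_gt s i : i < size s -> i < nextb s i.
Proof.
move=> lt_i; rewrite /nextb -[X in X < _]addn0 ltn_add2l hrun_gt0 //.
by rewrite size_drop subn_gt0.
Qed.

Lemma nextb_bd s i : i < size s -> bd s (nextb s i).
Proof.
move=> lt_i; have := nextb_gt lt_i; rewrite /bd /nextb.
have [//|lt_h h0] := leqP (size s) (i + hrun (drop i s)); first by rewrite orbT.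
apply/or3P/Or33; have := @hrun_max (drop i s).
have := @hrun_const (drop i s) (hrun (drop i s)).-1.
rewrite size_drop !nth_drop addn0 (_ : i + _.-1 = (i + hrun (drop i s)).-1); last by lia.
move=> -> //; last by lia.
by apply; lia.
Qed.

(** Ensures that loops hopping with [nextb] miss no boundary. *)
Lemma before_nextb s i k : i < k < nextb s i -> ~~ bd s k.
Proof.
rewrite /nextb; case/andP=> ik kh; have := hrun_le (drop i s); rewrite size_drop => hs.
rewrite /bd !negb_or negbK; apply/and3P; split; [lia|lia|].
have := @hrun_const (drop i s) (k - i); have := @hrun_const (drop i s) (k - i).-1.
rewrite !nth_drop (_ : i + (k - i).-1 = k.-1) ?subnKC; [|lia..].
move=> ->; last by lia.
by move=> ->; [exact: eqxx|lia].
Qed.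

Lemma hrun_bd s i : i < size s -> (hrun (drop i s) == 1) = bd s i.+1.
Proof.
move=> lt_i; have := nextb_bd lt_i; have := nextb_gt lt_i.
have := @before_nextb s i i.+1; rewrite /nextb.
case: (hrun (drop i s)) => [|[|k]] h; first by rewrite addn0 ltnn.
  by rewrite addn1 => _ ->.
by move=> _ _; apply/esym/negbTE/h; lia.
Qed.

(** The test by which the program recognises a boundary: letter [i] closes its run when the rest of
    the run has length 1. *)
Lemma bd_rl_rev s i : i < size s -> (rl (rev s) (size s - i) == 1) = bd s i.+1.
Proof.
by move=> lt_i; rewrite -hrun_bd // /rl take_rev revK subKn // ltnW.
Qed.

Lemma bd_rev s i : i <= size s -> bd s i -> bd (rev s) (size s - i).
Proof.
move=> le_i; rewrite /bd size_rev => /or3P [/eqP ->|ge_i|ne].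
- by rewrite subn0 leqnn orbT.
- by have -> : size s - i = 0 by lia.
have [i0|i0] := posnP i; first by rewrite i0 subn0 leqnn orbT.
have [->//|lt_i] := posnP (size s - i).
apply/or3P/Or33; rewrite !nth_rev; [|lia..].
have -> : size s - (size s - i).+1 = i.-1 by lia.
have -> : size s - (size s - i).-1.+1 = i by lia.
by rewrite eq_sym.
Qed.

(** * Counting runs *)

Lemma rle_head x s : exists k r, rle (x :: s) = (x, k) :: r.
Proof.
move=> /=; case: (rle s) => [|[y k] r]; first by exists 1, [::].
by case: eqP => [->|_]; [exists k.+1, r | exists 1, ((y, k) :: r)].
Qed.

Lemma size_rle_cons x s :
  size (rle (x :: s)) = (hrun (x :: s) == 1) + size (rle s).
Proof.
case: s => [|y s]; first by rewrite hrun1.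
rewrite hrun_cons2; have h0 := @hrun_gt0 (y :: s) isT.
have [k [r E]] := rle_head y s.
have -> : rle [:: x, y & s] =
  if rle (y :: s) is (y, k) :: r then
      if x == y then (y, k.+1) :: r else (x, 1) :: (y, k) :: r
    else [:: (x, 1)] by [].
rewrite E eqSS muln_eq0 (gtn_eqF h0) eqb0 eq_sym.
by case: (y == x).
Qed.

(** For loops that advance letter by letter, the number of remaining runs is a potential that pays
    only at boundaries. *)
Lemma size_rle_drop s i : i < size s ->
  size (rle (drop i s)) = bd s i.+1 + size (rle (drop i.+1 s)).
Proof.
move=> lt_i; rewrite -hrun_bd // (drop_nth x0 lt_i) size_rle_cons.
done.
Qed.

Lemma size_rle_hrun s : 0 < size s ->
  size (rle s) = (size (rle (drop (hrun s) s))).+1.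
Proof.
elim: s => // x [|y s] IH _; first by rewrite hrun1.
have h0 := @hrun_gt0 (y :: s) isT.
rewrite size_rle_cons hrun_cons2; case: (y == x); rewrite ?muln0 ?muln1 //.
by rewrite eqSS (gtn_eqF h0) IH.
Qed.

(** For loops that hop between boundaries, the same potential drops by one per iteration. *)
Lemma size_rle_nextb s i : i < size s ->
  size (rle (drop i s)) = (size (rle (drop (nextb s i) s))).+1.
Proof.
by move=> lt_i; rewrite size_rle_hrun ?size_drop ?subn_gt0 // drop_drop addnC.
Qed.

Lemma size_rle_cons2 x y s :
  size (rle [:: x, y & s]) = (x != y) + size (rle (y :: s)).
Proof.
rewrite size_rle_cons hrun_cons2 eqSS muln_eq0 (gtn_eqF (@hrun_gt0 (y :: s) isT)).
by rewrite eqb0 eq_sym.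
Qed.

Lemma size_rle_rcons2 x y s :
  size (rle (rcons (rcons s x) y)) = (x != y) + size (rle (rcons s x)).
Proof.
elim: s => [|a [|b s] IH]; first exact: (size_rle_cons2 x y [::]).
  rewrite [rcons (rcons _ _) _]/= [rcons _ _]/= !size_rle_cons2.
  exact: addnCA.
by rewrite !rcons_cons !size_rle_cons2 -!rcons_cons IH addnCA.
Qed.

Lemma size_rle_rev s : size (rle (rev s)) = size (rle s).
Proof.
elim: s => // x [//|y s] IH; rewrite rev_cons {1}rev_cons size_rle_rcons2.
by rewrite -rev_cons IH size_rle_cons2 eq_sym.
Qed.

Lemma size_rle_le s : size (rle s) <= size s.
Proof. by elim: s => // x s IH; rewrite size_rle_cons (leq_add (leq_b1 _) IH). Qed.

Lemma size_rle_map (U : eqType) (f : T -> U) s :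
  injective f -> size (rle (map f s)) = size (rle s).
Proof.
move=> inj_f; suff -> : rle (map f s) = [seq (f p.1, p.2) | p <- rle s].
  by rewrite size_map.
elim: s => //= x s ->; case: (rle s) => [|[y k] r] //=.
by rewrite (inj_eq inj_f); case: eqP.
Qed.

End Runs.

(** * Common subsequences and greedy matching *)

Section LCS.

Variable T : eqType.
Implicit Types (s t z a x p : seq T).

(** The nested fixpoint permits recursion on either argument. *)
Fixpoint lcs s :=
  fix lcs_s t := match s, t with
  | c :: s', d :: t' =>
      if c == d then (lcs s' t').+1 else maxn (lcs s' t) (lcs_s t')
  | _, _ => 0
  end.

Lemma lcs0 s : lcs s [::] = 0. Proof. by case: s. Qed.

Lemma lcs_cons c s d t : lcs (c :: s) (d :: t) =
  if c == d then (lcs s t).+1 else maxn (lcs s (d :: t)) (lcs (c :: s) t).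
Proof. by []. Qed.

Lemma lcs_max s t z : subseq z s -> subseq z t -> size z <= lcs s t.
Proof.
elim: s t z => [|c s IHs] t z; first by rewrite subseq0 => /eqP ->.
elim: t z => [|d t IHt] z; first by rewrite subseq0 => _ /eqP ->.
case: z => // e z zs zt; rewrite lcs_cons; case: (eqVneq c d) => [ecd|ncd].
  rewrite ltnS IHs //.
  - by move: zs => /=; case: eqP => // _ /(subseq_trans (subseq_cons _ _)).
  - by move: zt => /=; case: eqP => // _ /(subseq_trans (subseq_cons _ _)).
have zs' : subseq (if e == c then z else e :: z) s := zs.
have zt' : subseq (if e == d then z else e :: z) t := zt.
rewrite leq_max; case: (eqVneq e c) zs' zt' => [->|_] zs' zt'; last by rewrite IHs.
by rewrite (negbTE ncd) in zt'; rewrite IHt ?orbT //= eqxx.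
Qed.

Lemma lcs_ex s t : exists z, [/\ subseq z s, subseq z t & size z = lcs s t].
Proof.
elim: s t => [|c s IHs] t; first by exists [::]; case: t.
elim: t => [|d t [z2 [z2s z2t e2]]]; first by exists [::].
rewrite lcs_cons; case: (eqVneq c d) => [<-|ncd].
  have [z [zs zt ez]] := IHs t; exists (c :: z).
  by rewrite /= eqxx zs zt ez.
have [z1 [z1s z1t e1]] := IHs (d :: t).
have [_|_] := leqP (lcs s (d :: t)) (lcs (c :: s) t).
  by exists z2; split=> //; apply: subseq_trans z2t (subseq_cons _ _).
by exists z1; split=> //; apply: subseq_trans z1s (subseq_cons _ _).
Qed.

Lemma lcs_mono s s' t t' : subseq s s' -> subseq t t' -> lcs s t <= lcs s' t'.
Proof.
move=> ss' tt'; have [z [zs zt <-]] := lcs_ex s t.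
by apply: lcs_max; [apply: subseq_trans zs ss' | apply: subseq_trans zt tt'].
Qed.

(* One plus the length of what is left of [a] after greedily erasing from its
   front the shortest part containing [x] as a subsequence; 0 if there is none. *)
Fixpoint strip a x : nat :=
  match a, x with
  | _, [::] => (size a).+1
  | [::], _ => 0
  | d :: a', c :: x' => if c == d then strip a' x' else strip a' x
  end.

Lemma strip_nil a : strip a [::] = (size a).+1. Proof. by case: a. Qed.

Lemma strip_sound a x k : strip a x = k.+1 ->
  exists a1 a2, [/\ a = a1 ++ a2, size a2 = k & subseq x a1].
Proof.
elim: a x => [|d a IH] [|c x] //=.
- by case=> <-; exists [::], [::].
- by case=> <-; exists [::], (d :: a).
case: eqP => [->|ncd] /IH [a1 [a2 [-> e sx]]]; exists (d :: a1), a2; split=> //=.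
  by rewrite eqxx.
by case: eqP.
Qed.

(** Greedy erasure uses the shortest possible front part, so any [p] that fits behind some embedding
    of [x] also fits into what is left. *)
Lemma strip_complete a x p : subseq (x ++ p) a ->
  exists k a1 a2, [/\ strip a x = k.+1, a = a1 ++ a2, size a2 = k & subseq p a2].
Proof.
elim: a x => [|d a IH] [|c x] //=.
- by move=> sp; exists 0, [::], [::].
- by move=> sp; exists (size a).+1, [::], (d :: a).
case: (c == d).
- by move=> /IH [k [a1 [a2 [e ea s2 sp]]]]; exists k, (d :: a1), a2;
     rewrite ea in e *.
by rewrite -cat_cons => /IH [k [a1 [a2 [e ea s2 sp]]]]; exists k, (d :: a1), a2;
   rewrite ea in e *.
Qed.

End LCS.

(** * LCS and greedy matching on prefixes, with jumps over runs *)

Section Prefixes.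

Variables (T : eqType) (x0 : T).
Implicit Types (A B X P : seq T).

(** Reversal makes the head recursion of [lcs] work at the right ends of the prefixes, which yields
    the usual table recurrence [plcsSS]. *)
Definition plcs A B i j : nat := lcs (rev (take i A)) (rev (take j B)).

(** The greedy matching of [take j X] runs leftwards from position [i] of [A]; the value [k.+1]
    means that the prefix of length [k] stays free. *)
Definition pstrip A X i j : nat := strip (rev (take i A)) (rev (take j X)).

Lemma rev_takeS A i : i < size A ->
  rev (take i.+1 A) = nth x0 A i :: rev (take i A).
Proof. by move=> lt_i; rewrite (take_nth x0 lt_i) rev_rcons. Qed.

Lemma subseq_rev_take A i i' : i <= i' ->
  subseq (rev (take i A)) (rev (take i' A)).
Proof.
by move=> le_i; rewrite subseq_rev -(subnKC le_i) takeD prefix_subseq.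
Qed.

Lemma plcs0l A B j : plcs A B 0 j = 0.
Proof. by rewrite /plcs take0; case: (rev (take j B)). Qed.

Lemma plcs0r A B i : plcs A B i 0 = 0.
Proof. by rewrite /plcs take0 lcs0. Qed.

Lemma plcs_mono A B i i' j j' : i <= i' -> j <= j' ->
  plcs A B i j <= plcs A B i' j'.
Proof. by move=> *; apply: lcs_mono; apply: subseq_rev_take. Qed.

Lemma plcs_le A B i j : plcs A B i j <= i.
Proof.
rewrite /plcs; have [z [zs _ <-]] := lcs_ex (rev (take i A)) (rev (take j B)).
apply: leq_trans (size_subseq zs) _.
by rewrite size_rev size_take_min geq_minl.
Qed.

Lemma plcs_le_size A B i j : plcs A B i j <= size A.
Proof.
rewrite /plcs; have [z [zs _ <-]] := lcs_ex (rev (take i A)) (rev (take j B)).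
apply: leq_trans (size_subseq zs) _.
by rewrite size_rev size_take_min geq_minr.
Qed.

Lemma plcs_max A B i j P : subseq P (take i A) -> subseq P (take j B) ->
  size P <= plcs A B i j.
Proof.
by move=> pa pb; rewrite -(size_rev P); apply: lcs_max; rewrite subseq_rev.
Qed.

Lemma plcs_ex A B i j : exists P,
  [/\ subseq P (take i A), subseq P (take j B) & size P = plcs A B i j].
Proof.
have [z [za zb e]] := lcs_ex (rev (take i A)) (rev (take j B)).
exists (rev z); rewrite size_rev e; split=> //.
  by rewrite -(revK (take i A)) subseq_rev.
by rewrite -(revK (take j B)) subseq_rev.
Qed.

Lemma plcsSS A B i j : i < size A -> j < size B ->
  plcs A B i.+1 j.+1 = if nth x0 A i == nth x0 B j then (plcs A B i j).+1
                       else maxn (plcs A B i j.+1) (plcs A B i.+1 j).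
Proof. by move=> ia jb; rewrite /plcs !rev_takeS // lcs_cons. Qed.

(** The diagonal stays within two runs of the same letter, so each of the [d] steps back matches one
    pair. *)
Lemma plcs_diag A B i j d : i <= size A -> j <= size B ->
    nth x0 A i.-1 = nth x0 B j.-1 -> d <= rl A i -> d <= rl B j ->
  plcs A B i j = plcs A B (i - d) (j - d) + d.
Proof.
move=> ia jb e; elim: d => [|d IH] di dj; first by rewrite !subn0 addn0.
have ri := rl_le A i; have rj := rl_le B j.
rewrite IH; try lia.
have -> : i - d = (i - d.+1).+1 by lia.
have -> : j - d = (j - d.+1).+1 by lia.
rewrite plcsSS; try lia.
rewrite (@rl_const _ x0 A i) ?(@rl_const _ x0 B j) ?e ?eqxx; lia.
Qed.

(** No two letters of the block match, so every cell is the maximum of two neighbours and all values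
    come in through the two borders. *)
Lemma plcs_block A B i j : i <= size A -> j <= size B ->
    nth x0 A i.-1 != nth x0 B j.-1 ->
  plcs A B i j = maxn (plcs A B (i - rl A i) j) (plcs A B i (j - rl B j)).
Proof.
move=> ia jb ne; have ri := rl_le A i; have rj := rl_le B j.
(* [p] and [q] are offsets from the corner of the block, and [w] bounds their sum for the induction.
   On a border the equation follows from monotonicity. *)
suff H w p q : p + q <= w -> i - rl A i + p <= i -> j - rl B j + q <= j ->
    plcs A B (i - rl A i + p) (j - rl B j + q) =
    maxn (plcs A B (i - rl A i) (j - rl B j + q))
         (plcs A B (i - rl A i + p) (j - rl B j)).
  by have := H _ (rl A i) (rl B j) (leqnn _); rewrite !subnK //; apply.
elim: w p q => [|w IH] p q.
  rewrite leqn0 addn_eq0 => /andP [/eqP -> /eqP ->] _ _.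
  by rewrite !addn0 maxnn.
case: p => [|p] le_w.
  rewrite addn0 => _ _; apply/esym/maxn_idPl.
  by apply: plcs_mono; lia.
case: q le_w => [|q] le_w.
  rewrite addn0 => _ _; apply/esym/maxn_idPr.
  by apply: plcs_mono; lia.
move=> hp hq; rewrite !addnS in hp hq le_w *.
rewrite plcsSS; try lia.
rewrite (@rl_const _ x0 A i) ?(@rl_const _ x0 B j) ?(negbTE ne); try lia.
rewrite -addnS IH; try lia.
rewrite -[(i - _ + p).+1]addnS [plcs A B _ (_ + q)]IH; try lia.
have h1 : plcs A B (i - rl A i) (j - rl B j + q) <=
          plcs A B (i - rl A i) (j - rl B j + q.+1).
  by apply: plcs_mono; lia.
have h2 : plcs A B (i - rl A i + p) (j - rl B j) <=
          plcs A B (i - rl A i + p.+1) (j - rl B j).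
  by apply: plcs_mono; lia.
lia.
Qed.

Lemma pstrip0r A X i : i <= size A -> pstrip A X i 0 = i.+1.
Proof.
by move=> le_i; rewrite /pstrip take0 strip_nil size_rev size_takel.
Qed.

Lemma pstrip0l A X j : 0 < j <= size X -> pstrip A X 0 j = 0.
Proof.
case: j => // j jx; rewrite /pstrip take0 rev_takeS //.
Qed.

Lemma pstripSS A X i j : i < size A -> j < size X ->
  pstrip A X i.+1 j.+1 = if nth x0 A i == nth x0 X j then pstrip A X i j
                         else pstrip A X i j.+1.
Proof. by move=> ia jb; rewrite /pstrip !rev_takeS //= eq_sym. Qed.

Lemma pstrip_diag A X i j d : i <= size A -> j <= size X ->
    nth x0 A i.-1 = nth x0 X j.-1 -> d <= rl A i -> d <= rl X j ->
  pstrip A X i j = pstrip A X (i - d) (j - d).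
Proof.
move=> ia jb e; elim: d => [|d IH] di dj; first by rewrite !subn0.
have ri := rl_le A i; have rj := rl_le X j.
rewrite IH; try lia.
have -> : i - d = (i - d.+1).+1 by lia.
have -> : j - d = (j - d.+1).+1 by lia.
rewrite pstripSS; try lia.
rewrite (@rl_const _ x0 A i) ?(@rl_const _ x0 X j) ?e ?eqxx; lia.
Qed.

Lemma pstrip_skip A X i i' j : i' <= i <= size A -> 0 < j <= size X ->
    (forall k, i' <= k < i -> nth x0 A k != nth x0 X j.-1) ->
  pstrip A X i j = pstrip A X i' j.
Proof.
case/andP=> /subnKC <-; elim: (i - i') => [|d IH] ia jx ne; first by rewrite addn0.
rewrite addnS -(prednK (n := j)); last by lia.
rewrite pstripSS; [|lia..].
rewrite (negbTE (ne _ _)) ?(prednK (n := j)) ?IH //; try lia.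
by move=> k hk; apply: ne; lia.
Qed.

(** The run of [A] ending at [i] is consumed in one go, so only boundary rows are read. After [d]
    matches, if the run of [X] ended first, its preceding letter differs from the run of [A], whose
    rest is skipped. If [take j X] is used up, the position [i - d] may lie inside the run. *)
Lemma pstrip_run A X i j (d := minn (rl A i) (rl X j)) :
    i <= size A -> 0 < j <= size X ->
  pstrip A X i j =
    if nth x0 A i.-1 == nth x0 X j.-1 then
      if j == d then (i - d).+1 else pstrip A X (i - rl A i) (j - d)
    else pstrip A X (i - rl A i) j.
Proof.
move=> ia jx; have ri := rl_le A i; have rj := rl_le X j.
have const k : i - rl A i <= k < i -> nth x0 A k = nth x0 A i.-1.
  exact: rl_const.
have [e|ne] := eqVneq; last first.
  by apply: pstrip_skip => [||k /const ->]; rewrite ?leq_subr.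
rewrite (@pstrip_diag A X i j d) //; try lia.
have [ed|nd] := eqVneq j d; first by rewrite -ed subnn pstrip0r //; lia.
have [le_r|gt_r] := leqP (rl A i) (rl X j); first by congr pstrip; lia.
have ed : d = rl X j by rewrite /d; lia.
apply: pstrip_skip; [lia|lia|move=> k hk].
by rewrite const ?e; [rewrite eq_sym ed rl_max|]; lia.
Qed.

Lemma pstrip_sound A X i j k : i <= size A -> pstrip A X i j = k.+1 ->
  k <= i /\ subseq (take k A ++ take j X) (take i A).
Proof.
move=> ia /strip_sound [a1 [a2 [e ek sx]]].
have e' : take i A = rev a2 ++ rev a1 by rewrite -[LHS]revK e rev_cat.
have ki : k <= i.
  have := congr1 size e; rewrite size_rev size_takel // size_cat; lia.
split=> //; rewrite e'; apply: cat_subseq; last by rewrite -subseq_rev revK.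
by rewrite -(take_takel _ ki) e' take_size_cat ?size_rev.
Qed.

Lemma pstrip_complete A X P i j : i <= size A ->
    subseq (P ++ take j X) (take i A) ->
  exists k, pstrip A X i j = k.+1 /\ subseq P (take k A).
Proof.
move=> ia; rewrite -subseq_rev rev_cat => /strip_complete.
case=> k [a1 [a2 [ek e e2 sp]]]; exists k; split=> //.
have e' : take i A = rev a2 ++ rev a1 by rewrite -[LHS]revK e rev_cat.
have ki : k <= i.
  have := congr1 size e; rewrite size_rev size_takel // size_cat; lia.
rewrite -subseq_rev -(take_takel _ ki) e' take_size_cat ?size_rev //.
by rewrite revK.
Qed.

Lemma pstrip_le A X i j : i <= size A -> pstrip A X i j <= i.+1.
Proof.
move=> ia; case e : (pstrip A X i j) => [|k] //.
by have [] := pstrip_sound ia e.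
Qed.

(** * Cutting the constraint at run boundaries; candidates *)

Lemma subseq_split A X y Y : subseq (X ++ y :: Y) A -> exists u,
  [/\ u < size A, subseq X (take u A), nth x0 A u = y & subseq Y (drop u.+1 A)].
Proof.
elim: A X => [|a A IH] X /=; first by case: X.
case: X => [|x X] /=.
  case: eqP => [->|_] sy; first by exists 0; rewrite drop0 sub0seq.
  by have [u [? ? ? ?]] := IH [::] sy; exists u.+1; rewrite sub0seq.
case: eqP => [->|ne] s0.
  by have [u [? ? ? ?]] := IH X s0; exists u.+1; rewrite /= eqxx.
by have [u [? ? ? ?]] := IH (x :: X) s0; exists u.+1; rewrite /=; case: eqP.
Qed.

Lemma subseq_rcons_ne X x A a :
  x != a -> subseq (rcons X x) (rcons A a) -> subseq (rcons X x) A.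
Proof.
move=> ne; rewrite -subseq_rev !rev_rcons /= (negbTE ne) -rev_rcons.
by rewrite subseq_rev.
Qed.

(* The least admissible split starting with [y] is a run boundary: from inside a
   run of [y] it could be moved to the left, as [x != y]. *)
Lemma subseq_split_bd A X x y Y : x != y ->
    subseq (rcons X x ++ y :: Y) A ->
  exists u, [/\ u < size A, bd x0 A u, subseq (rcons X x) (take u A)
               & subseq (y :: Y) (drop u A)].
Proof.
move=> ne /subseq_split [u0 [lt0 sx0 e0 sy0]].
pose p u := [&& u < size A, subseq (rcons X x) (take u A), nth x0 A u == y
              & subseq Y (drop u.+1 A)].
have ex_p : exists u, p u by exists u0; rewrite /p lt0 sx0 e0 eqxx sy0.
case: (ex_minnP ex_p) => u /and4P [lt_u sx /eqP ey sy] min_u.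
exists u; split=> //; last by rewrite (drop_nth x0 lt_u) /= ey eqxx.
rewrite /bd leqNgt lt_u; case: u => [|u] //= in lt_u sx ey sy min_u *.
apply/eqP => eyu; suff /min_u : p u by rewrite ltnn.
rewrite /p -eyu ey eqxx (ltnW lt_u) /=; apply/andP; split.
  move: sx; rewrite (take_nth x0 (ltnW lt_u)); apply: subseq_rcons_ne.
  by rewrite -eyu ey.
by rewrite (subseq_trans sy) // (drop_nth x0 lt_u) subseq_cons.
Qed.

(* The pair of greedy matchings of [C] cut at [h], at the boundaries [u] of [A]
   and [v] of [B]; 0 if one of the four half matchings does not exist. *)
Definition cand A B C h u v : nat :=
  let x := pstrip A C u h in
  let y := pstrip B C v h in
  let x' := pstrip (rev A) (rev C) (size A - u) (size C - h) in
  let y' := pstrip (rev B) (rev C) (size B - v) (size C - h) in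
  if [&& 0 < x, 0 < y, 0 < x' & 0 < y'] then
    plcs A B x.-1 y.-1 + plcs (rev A) (rev B) x'.-1 y'.-1 + size C
  else 0.

(** The half matchings lie on either side of [u], and [P] and [rev R] embed in what these leave
    free, so the four pieces concatenate. *)
Lemma cand_sound_half A C h u k k' P R :
    u <= size A -> pstrip A C u h = k.+1 ->
    pstrip (rev A) (rev C) (size A - u) (size C - h) = k'.+1 ->
    subseq P (take k A) -> subseq R (take k' (rev A)) -> h <= size C ->
  subseq (P ++ C ++ rev R) A.
Proof.
move=> ua ek ek' sp sr hc.
have [_ s1] := pstrip_sound ua ek.
have [|_ s2] := pstrip_sound _ ek'; first by rewrite size_rev leq_subr.
rewrite !take_rev !subKn // -rev_cat in s2 *.
rewrite -(cat_take_drop u A) -{1}(cat_take_drop h C) -catA catA.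
apply: cat_subseq.
  by apply: subseq_trans s1; apply: cat_subseq.
rewrite -subseq_rev; apply: subseq_trans s2; rewrite !rev_cat revK.
by rewrite take_rev in sr; apply: cat_subseq.
Qed.

Lemma cand_sound A B C h u v :
    u <= size A -> v <= size B -> h <= size C -> 0 < cand A B C h u v ->
  exists2 Z, str_ic_cs A B C Z & size Z = cand A B C h u v.
Proof.
move=> ua vb hc; rewrite /cand.
case ex : (pstrip A C u h) => [|k] //=; case ey : (pstrip B C v h) => [|l] //=.
case ex' : (pstrip (rev A) _ _ _) => [|k'] //=.
case ey' : (pstrip (rev B) _ _ _) => [|l'] //= _.
have [P [pa pb <-]] := plcs_ex A B k l.
have [R [ra rb <-]] := plcs_ex (rev A) (rev B) k' l'.
exists (P ++ C ++ rev R); last by rewrite !size_cat size_rev; lia.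
split; first by apply/infixP; exists P, (rev R).
  exact: cand_sound_half ex ex' pa ra hc.
exact: cand_sound_half ey ey' pb rb hc.
Qed.

(** The letters [h.-1] and [h] of [C] differ, so the cut between them moves to a run boundary [u] of
    [A]; greediness on both sides leaves room for [P] and [R]. *)
Lemma cand_complete_half A C h P R :
    0 < h < size C -> nth x0 C h != nth x0 C h.-1 -> subseq (P ++ C ++ R) A ->
  exists u k k', [/\ u < size A, bd x0 A u, pstrip A C u h = k.+1 /\
     pstrip (rev A) (rev C) (size A - u) (size C - h) = k'.+1,
     subseq P (take k A) & subseq (rev R) (take k' (rev A))].
Proof.
move=> /andP [h0 hc] ne.
rewrite -{1}(cat_take_drop h C) (drop_nth x0 hc) -{1}(prednK h0).
rewrite (take_nth x0); last by lia.
rewrite -catA catA -rcons_cat /= => /subseq_split_bd [|u [ua bu s1 s2]].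
  by rewrite eq_sym.
rewrite rcons_cat -take_nth ?prednK // in s1; last by lia.
rewrite -cat_cons -drop_nth // in s2.
have [|k [ek sk]] := pstrip_complete _ s1; first exact: ltnW.
have := @pstrip_complete (rev A) (rev C) (rev R) (size A - u) (size C - h).
rewrite size_rev leq_subr !take_rev !subKn ?(ltnW ua) ?(ltnW hc) // -rev_cat.
rewrite subseq_rev => /(_ isT s2) [k' [ek' sk']].
by exists u, k, k'.
Qed.

(** The cut of [C] is fixed, so [u] and [v] are found independently in [A] and [B]; [P] and [R] are
    then common subsequences of the free parts. *)
Lemma cand_complete A B C h Z :
    0 < h < size C -> nth x0 C h != nth x0 C h.-1 -> str_ic_cs A B C Z ->
  exists u v, [/\ u < size A, bd x0 A u, v < size B, bd x0 B v
                & size Z <= cand A B C h u v].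
Proof.
move=> hh ne [/infixP [P [R ->]] sa sb].
have [u [k [k' [ua bu [ek ek'] pa ra]]]] := cand_complete_half hh ne sa.
have [v [l [l' [vb bv [el el'] pb rb]]]] := cand_complete_half hh ne sb.
exists u, v; split=> //; rewrite /cand ek el ek' el' /= !size_cat.
have := plcs_max pa pb; have := plcs_max ra rb; rewrite size_rev; lia.
Qed.

End Prefixes.

(** * Invariance under injective renaming of letters *)

Section Injection.

Variables (T U : eqType) (f : T -> U).
Hypothesis inj_f : injective f.
Implicit Types A B C Z : seq T.

Lemma str_ic_cs_map A B C Z :
  str_ic_cs A B C Z -> str_ic_cs (map f A) (map f B) (map f C) (map f Z).
Proof.
case=> /infixP [P [R ->]] za zb; split; try exact: map_subseq.
by apply/infixP; exists (map f P), (map f R); rewrite !map_cat.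
Qed.

(** A feasible string over the codes is a subsequence of [map f A], so a mask of [A] decodes it. *)
Lemma str_ic_cs_map_inv A B C (Z : seq U) :
    str_ic_cs (map f A) (map f B) (map f C) Z ->
  exists2 Z0, Z = map f Z0 & str_ic_cs A B C Z0.
Proof.
have sub_inv X Y : subseq (map f X) (map f Y) -> subseq X Y.
  case/subseqP=> m _; rewrite -map_mask => /(inj_map inj_f) ->.
  exact: mask_subseq.
case=> cz za zb; have [m _ ez] := subseqP za; rewrite -map_mask in ez.
exists (mask m A) => //; rewrite {}ez in cz za zb.
split; [|exact: mask_subseq|exact: sub_inv zb].
have /infixP [P [R e]] := cz; apply/infixP.
exists (take (size P) (mask m A)), (drop (size C) (drop (size P) (mask m A))).
apply: (inj_map inj_f); rewrite !map_cat !map_take !map_drop e take_size_cat //.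
by rewrite !drop_size_cat ?size_map.
Qed.

Lemma str_ic_lcs_answer_map A B C r :
  str_ic_lcs_answer (map f A) (map f B) (map f C) r ->
  str_ic_lcs_answer A B C r.
Proof.
case=> [[Z [/str_ic_cs_map_inv [Z0 -> cZ] maxZ] <-]|[noZ ->]].
  left; exists Z0; rewrite ?size_map //; split=> // Z' /str_ic_cs_map /maxZ.
  by rewrite !size_map.
by right; split=> // Z /str_ic_cs_map /noZ.
Qed.

End Injection.

Arguments update T f x v y /.

(** * Total correctness with time bounds *)

Fixpoint wregs (c : cmd) : seq nat :=
  match c with
  | Skip | Store _ _ _ => [::]
  | Assign x _ => [:: x]
  | Seq c1 c2 | If _ c1 c2 => wregs c1 ++ wregs c2
  | While _ c => wregs c
  end.

Fixpoint warrs (c : cmd) : seq nat :=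
  match c with
  | Skip | Assign _ _ => [::]
  | Store a _ _ => [:: a]
  | Seq c1 c2 | If _ c1 c2 => warrs c1 ++ warrs c2
  | While _ c => warrs c
  end.

(** Relies on the syntactic assignment targets of [c], so specifications need not list the unchanged
    memory. *)
Definition frame (c : cmd) (s s' : state) : Prop :=
  (forall x, x \notin wregs c -> reg s' x = reg s x) /\
  (forall a, a \notin warrs c -> arr s' a = arr s a).

Lemma frame_trans c s1 s2 s3 : frame c s1 s2 -> frame c s2 s3 -> frame c s1 s3.
Proof.
by move=> [r1 a1] [r2 a2]; split=> [x xc|a ac]; rewrite ?r2 ?r1 ?a2 ?a1.
Qed.

Lemma frame_sub c c' s s' : {subset wregs c <= wregs c'} ->
  {subset warrs c <= warrs c'} -> frame c s s' -> frame c' s s'.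
Proof.
move=> sr sa [r1 a1]; split=> [x|a] xc.
  by rewrite r1 //; apply: contra xc; apply: sr.
by rewrite a1 //; apply: contra xc; apply: sa.
Qed.

Definition Loop (x y : nat) (c : cmd) := While (Bin Lt (Reg x) (Reg y)) c.

Definition For (x y : nat) (c : cmd) := Seq (Assign x (Cst 0)) (Loop x y c).

Section Hoare.

Variable W : nat.
Implicit Types (s : state) (c : cmd) (e : expr) (Q : state -> Prop).

Lemma exec_frame c s t s' : exec W c s t s' -> frame c s s'.
Proof.
elim=> {c s t s'} //=.
- move=> s x e v _; split=> // y; rewrite inE /= /update.
  by move=> /negbTE ->.
- move=> s a e1 e2 i v _ _; split=> // b; rewrite inE /= /update.
  by move=> /negbTE ->.
- move=> s1 s2 s3 c1 c2 t1 t2 _ f1 _ f2; apply: (frame_trans (s2 := s2)).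
    by apply: frame_sub f1 => x /=; rewrite mem_cat => ->.
  by apply: frame_sub f2 => x /=; rewrite mem_cat orbC => ->.
- move=> s s' e c1 c2 v t _ _; case: (v != 0) => f1.
    by apply: frame_sub f1 => x /=; rewrite mem_cat => ->.
  by apply: frame_sub f1 => x /=; rewrite mem_cat orbC => ->.
- move=> s1 s2 s3 e c v t1 t2 _ _ _ f1 _; apply: frame_trans.
  exact: f1.
Qed.

(** Total correctness from one start state, with at most [T] steps; preconditions become ordinary
    hypotheses on [s]. *)
Definition tri s c (T : nat) Q : Prop :=
  exists t s', [/\ exec W c s t s', t <= T & Q s'].

Lemma tri_weaken s c T T' Q Q' : tri s c T Q ->
  T <= T' -> (forall s', Q s' -> frame c s s' -> Q' s') -> tri s c T' Q'.
Proof.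
move=> [t [s' [ex le q]]] leT h; exists t, s'; split=> //.
  exact: leq_trans le leT.
exact: h (exec_frame ex).
Qed.

Lemma tri_seq s c1 c2 T1 T2 Q1 Q : tri s c1 T1 Q1 ->
    (forall s', Q1 s' -> frame c1 s s' -> tri s' c2 T2 Q) ->
  tri s (Seq c1 c2) (T1 + T2).+1 Q.
Proof.
move=> [t1 [s1 [ex1 le1 q1]]] /(_ s1 q1 (exec_frame ex1)) [t2 [s2 [ex2 le2 q2]]].
exists (t1 + t2).+1, s2; split=> //; first exact: ExecSeq ex1 ex2.
by rewrite ltnS leq_add.
Qed.

(* [wpe] and [wp] compute weakest preconditions of loop-free code, including
   the absence of overflow. *)
Fixpoint wpe s e (K : nat -> Prop) : Prop :=
  match e with
  | Cst v => v < W /\ K v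
  | Reg x => K (reg s x)
  | Get a e1 => wpe s e1 (fun i => K (arr s a i))
  | Bin o e1 e2 => wpe s e1 (fun v1 => wpe s e2 (fun v2 =>
      binop_eval o v1 v2 < W /\ K (binop_eval o v1 v2)))
  end.

Fixpoint wp c Q s : Prop :=
  match c with
  | Skip => Q s
  | Assign x e => wpe s e (fun v => Q (set_reg s x v))
  | Store a e1 e2 => wpe s e1 (fun i => wpe s e2 (fun v => Q (set_arr s a i v)))
  | Seq c1 c2 => wp c1 (wp c2 Q) s
  | If e c1 c2 => wpe s e (fun v => if v != 0 then wp c1 Q s else wp c2 Q s)
  | While _ _ => False
  end.

(** The value at [While] is harmless, since [wp] is [False] there. *)
Fixpoint wcost c : nat :=
  match c with
  | Skip => 1
  | Assign _ e => (cost e).+1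
  | Store _ e1 e2 => (cost e1 + cost e2).+1
  | Seq c1 c2 => (wcost c1 + wcost c2).+1
  | If e c1 c2 => (cost e + maxn (wcost c1) (wcost c2)).+1
  | While _ _ => 0
  end.

Lemma wpe_eval s e K : wpe s e K -> exists2 v, eval W s e = Some v & K v.
Proof.
elim: e K => [v|x|a e IH|o e1 IH1 e2 IH2] K /=.
- by case=> lt_v k; exists v; rewrite /word ?lt_v.
- by exists (reg s x).
- by move=> /IH [v -> k]; exists (arr s a v).
move=> /IH1 [v1 -> /IH2 [v2 -> [lt_v k]]].
by exists (binop_eval o v1 v2); rewrite /word ?lt_v.
Qed.

Lemma wp_tri c Q s : wp c Q s -> tri s c (wcost c) Q.
Proof.
elim: c Q s => [|x e|a e1 e2|c1 IH1 c2 IH2|e c1 IH1 c2 IH2|e c IH] Q s //=.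
- by move=> q; exists 1, s; split=> //; constructor.
- move=> /wpe_eval [v ev q]; exists (cost e).+1, (set_reg s x v).
  by split=> //; constructor.
- move=> /wpe_eval [i ei /wpe_eval [v ev q]].
  by exists (cost e1 + cost e2).+1, (set_arr s a i v); split=> //; constructor.
- by move=> /IH1 h; apply: tri_seq h _ => s' /IH2.
move=> /wpe_eval [v ev q].
have {q} [t [s' [ex le q]]] : tri s (if v != 0 then c1 else c2)
    (maxn (wcost c1) (wcost c2)) Q.
  case: (v != 0) q => [/IH1|/IH2] h; apply: tri_weaken h _ _ => //.
    exact: leq_maxl.
  exact: leq_maxr.
exists (cost e + t).+1, s'; split=> //; first exact: ExecIf ev ex.
by rewrite ltnS leq_add2l.
Qed.

Lemma wp_post c Q s T : wp c Q s -> wcost c <= T -> tri s c T Q.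
Proof. by move=> /wp_tri h leT; apply: tri_weaken h leT _. Qed.

Lemma tri_loop x y c (I : nat -> state -> Prop) (Phi : nat -> nat) hi i0 s0 :
    1 < W -> y \notin wregs c -> reg s0 y = hi ->
    (forall i s, I i s -> reg s x = i /\ i <= hi) ->
    (forall i s, I i s -> frame c s0 s -> i < hi ->
       exists i' T, T + 4 + Phi i' <= Phi i /\ tri s c T (I i')) ->
    I i0 s0 ->
  tri s0 (Loop x y c) (Phi i0 + 4) (I hi).
Proof.
move=> W1 yc ey Ix step Ii0.
(* Induction on a strict bound for the potential. Each iteration lowers it by at least 4, the cost
   of the guard and the loop step. *)
suff H n i s : Phi i < n -> I i s -> frame c s0 s ->
    tri s (Loop x y c) (Phi i + 4) (I hi) by apply: (H _ _ _ (leqnn _)).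
elim: n i s => // n IH i s lt_n Ii fr; have [ex le_hi] := Ix _ _ Ii.
have eyi : reg s y = hi by rewrite fr.1.
have ev : eval W s (Bin Lt (Reg x) (Reg y)) = Some (nat_of_bool (i < hi)).
  by rewrite /= ex eyi /word; case: (i < hi); rewrite ?W1 ?(ltnW W1).
have [lt_i|ge_i] := ltnP i hi; last first.
  have e : i = hi by lia.
  rewrite e ltnn in ev Ii; exists 4, s; split=> //; last by lia.
  exact: ExecWhileEnd ev.
have [i' [T [leT [t1 [s1 [ex1 le1 Ii1]]]]]] := step _ _ Ii fr lt_i.
have [||t2 [s2 [ex2 le2 q]]] := IH i' s1 _ Ii1; first by lia.
  exact: frame_trans fr (exec_frame ex1).
rewrite lt_i in ev; exists (4 + t1 + t2), s2; split=> //; last by lia.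
exact: ExecWhileStep ev isT ex1 ex2.
Qed.

(* The potential [Phi] pays for the remaining iterations; [I] is indexed by the
   value of the counter, which the body may advance by more than 1. *)
Lemma tri_for x y c (I : nat -> state -> Prop) (Phi : nat -> nat) hi s0 T Q :
    1 < W -> y \notin wregs (For x y c) -> reg s0 y = hi ->
    I 0 (set_reg s0 x 0) ->
    (forall i s, I i s -> reg s x = i /\ i <= hi) ->
    (forall i s, I i s -> frame (For x y c) s0 s -> i < hi ->
       exists i' T, tri s c T (I i') /\ T + 4 + Phi i' <= Phi i) ->
    Phi 0 + 7 <= T ->
    (forall s, I hi s -> frame (For x y c) s0 s -> Q s) ->
  tri s0 (For x y c) T Q.
Proof.
move=> W1 yc ey I0 Ix step leT post.
apply: tri_weaken.
- apply: (tri_seq (Q1 := fun s => s = set_reg s0 x 0)).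
    by apply: wp_tri; split; first exact: ltnW.
  move=> s1 es1 fr1; rewrite {}es1 in fr1 *.
  apply: (tri_loop (I := I) (hi := hi) (Phi := Phi) (i0 := 0)) => //.
  + by rewrite inE negb_or in yc; have /andP [] := yc.
  + by rewrite fr1.1 // inE; rewrite inE negb_or in yc; have /andP [] := yc.
  + move=> i s Ii fr lt_i; have [|i' [T' [h1 h2]]] := step _ _ Ii _ lt_i.
      apply: frame_trans (frame_sub _ _ fr1) (frame_sub _ _ fr) => // z.
        by rewrite !inE => ->.
      by move=> zc; rewrite inE zc orbT.
    by exists i', T'.
- by rewrite /=; lia.
- exact: post.
Qed.

Lemma tri_if s e c1 c2 T Q :
    wpe s e (fun v => if v != 0 then tri s c1 T Q else tri s c2 T Q) ->
  tri s (If e c1 c2) (cost e + T).+1 Q.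
Proof.
case/wpe_eval=> v ev q; have [t [s' [ex le qs]]] : tri s (if v != 0 then c1 else c2) T Q.
  by case: (v != 0) q.
exists (cost e + t).+1, s'; split=> //; first exact: ExecIf ev ex.
by rewrite ltnS leq_add2l.
Qed.

End Hoare.

(** * The program *)

Declare Scope expr_scope.
Delimit Scope expr_scope with E.
Bind Scope expr_scope with expr.
Local Notation "# v" := (Cst v) (at level 5, v at level 0) : expr_scope.
Local Notation "$ x" := (Reg x) (at level 5, x at level 0) : expr_scope.
Local Notation "e1 + e2" := (Bin Add e1 e2) : expr_scope.
Local Notation "e1 - e2" := (Bin Defs.Sub e1 e2) : expr_scope.
Local Notation "e1 * e2" := (Bin Mul e1 e2) : expr_scope.
Local Notation "e1 == e2" := (Bin Eq e1 e2) : expr_scope.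
Local Notation "e1 < e2" := (Bin Lt e1 e2) : expr_scope.
Local Notation "x :<- e" := (Assign x e%E) (at level 75).
Local Notation "c1 ;; c2" := (Seq c1 c2) (at level 80, right associativity).

Definition holds s a (A : seq nat) := forall k, arr s a k = nth 0 A k.
Definition holds_rl s a (A : seq nat) := forall k, k <= size A -> arr s a k = rl A k.
Definition blank s a := forall k, arr s a k = 0.

(* Subroutines use fixed registers: the length of the string, or of the first of
   two strings, is in 10; the bound of inner loops is in 12. *)
Definition rev_cmd src dst :=
  For 11 10 (Store dst $11 (Get src ($10 - #1 - $11)) ;; 11 :<- $11 + #1).

Definition rl_cmd src dst :=
  For 11 10
    (Store dst ($11 + #1) (Get dst $11 * (Get src $11 == Get src ($11 - #1)) + #1) ;;
     11 :<- $11 + #1).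

(* Register 19 receives the LCS length of the prefixes of lengths $16 and $17;
   $14 is the row width of the table [t]. *)
Definition qry_cmd a b rla rlb t :=
  If (Get a ($16 - #1) == Get b ($17 - #1))
    (18 :<- Get rla $16 ;;
     If (Get rlb $17 < $18) (18 :<- Get rlb $17) Skip ;;
     19 :<- Get t (($16 - $18) * $14 + ($17 - $18)) + $18)
    (19 :<- Get t (($16 - Get rla $16) * $14 + $17) ;;
     18 :<- Get t ($16 * $14 + ($17 - Get rlb $17)) ;;
     If ($19 < $18) (19 :<- $18) Skip).

(* $15 tells whether row $16 is a run boundary, hence filled completely. *)
Definition lcs_row_cmd a b rla rlb rlrb t :=
  For 13 12
    (If $15 (17 :<- $13 + #1) (17 :<- $13 + Get rlrb ($12 - $13)) ;;
     qry_cmd a b rla rlb t ;;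
     Store t ($16 * $14 + $17) $19 ;;
     13 :<- $17).

(** Every row is visited. Row [$11 + 1] is a boundary when the run at letter [$11] has one letter
    left, which [rlra] reveals. *)
Definition lcs_cmd a b rla rlra rlb rlrb t :=
  For 11 10
    (16 :<- $11 + #1 ;;
     15 :<- (Get rlra ($10 - $11) == #1) ;;
     lcs_row_cmd a b rla rlb rlrb t ;;
     11 :<- $16).

(** Evaluates [pstrip_run]: register 14 holds the row, 13 the column, 12 the row width, and 16
    receives the result. *)
Definition strip_val_cmd a x rla rlx g :=
  If ($13 == #0) (16 :<- $14 + #1)
    (If (Get a ($14 - #1) == Get x ($13 - #1))
       (15 :<- Get rla $14 ;;
        If (Get rlx $13 < $15) (15 :<- Get rlx $13) Skip ;;
        If ($13 == $15) (16 :<- $14 - $15 + #1)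
          (16 :<- Get g (($14 - Get rla $14) * $12 + ($13 - $15))))
       (16 :<- Get g (($14 - Get rla $14) * $12 + $13))).

Definition strip_row_cmd a x rla rlx g :=
  For 13 12
    (strip_val_cmd a x rla rlx g ;;
     Store g ($14 * $12 + $13) $16 ;;
     13 :<- $13 + #1).

(** Only boundary rows are filled. In row 0 the entry for the empty string is 1; the others keep
    their initial 0, which means failure. *)
Definition strip_cmd a x rla rlra rlx g :=
  Store g #0 #1 ;;
  For 11 10
    (14 :<- $11 + Get rlra ($10 - $11) ;;
     strip_row_cmd a x rla rlx g ;;
     11 :<- $14).

Definition lcs_cell s t (A B : seq nat) i j :=
  arr s t (i * (size B).+1 + j) = plcs A B i j.
(** The full rectangle is addressed, but nothing is claimed at cells without a boundary
    coordinate. *)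
Definition lcs_table s t (A B : seq nat) := forall i j,
  i <= size A -> j <= size B -> bd 0 A i || bd 0 B j -> lcs_cell s t A B i j.
Definition strip_cell s g (A X : seq nat) h i j :=
  arr s g (i * h.+1 + j) = pstrip A X i j.
Definition strip_table s g (A X : seq nat) h := forall i j,
  i <= size A -> j <= h -> bd 0 A i -> strip_cell s g A X h i j.

Ltac outside :=
  rewrite /= ?mem_cat ?inE ?negb_or /=;
  repeat (apply/andP; split); first [assumption | done].

(** Copies the known facts on registers, arrays and tables to the new state when the command does
    not write to them. *)
Ltac carry fr :=
  match type of fr with frame _ ?s ?s' =>
    repeat match goal with
    | H : holds s ?a ?A |- _ =>
        lazymatch goal with
        | _ : holds s' a A |- _ => fail
        | _ => have ? : holds s' a A by (move=> ?; rewrite fr.2; [exact: H|outside])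
        end
    | H : holds_rl s ?a ?A |- _ =>
        lazymatch goal with
        | _ : holds_rl s' a A |- _ => fail
        | _ => have ? : holds_rl s' a A
                 by (move=> ? ?; rewrite fr.2; [exact: H|outside])
        end
    | H : blank s ?a |- _ =>
        lazymatch goal with
        | _ : blank s' a |- _ => fail
        | _ => have ? : blank s' a by (move=> ?; rewrite fr.2; [exact: H|outside])
        end
    | H : lcs_table s ?a ?A ?B |- _ =>
        lazymatch goal with
        | _ : lcs_table s' a A B |- _ => fail
        | _ => have ? : lcs_table s' a A B
                 by (rewrite /lcs_table /lcs_cell fr.2; [exact: H|outside])
        end
    | H : strip_table s ?a ?A ?B ?h |- _ =>
        lazymatch goal with
        | _ : strip_table s' a A B h |- _ => fail
        | _ => have ? : strip_table s' a A B h
                 by (rewrite /strip_table /strip_cell fr.2; [exact: H|outside])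
        end
    | H : reg s ?x = ?v |- _ =>
        lazymatch goal with
        | _ : reg s' x = v |- _ => fail
        | _ => have ? : reg s' x = v by (rewrite fr.1; [exact: H|outside])
        end
    end
  end.

Ltac regs s :=
  repeat match goal with H : reg s ?x = _ |- context [reg s ?x] => rewrite H end.

Ltac words := repeat (split; [by lia|]).

(** * Table-filling subroutines: correctness and cost *)

Section Programs.

Variable W : nat.

Lemma rev_cmd_spec s A src dst :
    src != dst -> reg s 10 = size A -> size A + 2 < W ->
    holds s src A -> blank s dst ->
  tri W s (rev_cmd src dst) (20 * size A + 20) (fun s' => holds s' dst (rev A)).
Proof.
move=> ne es hW hA hB.
apply: (tri_for (hi := size A) (Phi := fun i => 20 * (size A - i))
  (I := fun i s1 => [/\ reg s1 11 = i, i <= size A & forall k, arr s1 dst k =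
   if k < i then nth 0 A (size A - k.+1) else 0])) => //; try lia.
- by move=> i s1 [].
- move=> i s1 [ei _ hd] fr lt_i; exists i.+1; eexists; split.
    have hAi : holds s1 src A by carry fr.
    have esi : reg s1 10 = size A by carry fr.
    apply: wp_tri => /=; rewrite ei esi (hAi _).
    words; split=> //=; first by rewrite addn1.
    move=> k /=; rewrite eqxx /=; case: eqP => [->|nk].
      by rewrite ltnS leqnn; congr nth; lia.
    by rewrite hd (_ : (k < i.+1) = (k < i)) //; lia.
  by rewrite /=; lia.
move=> s1 [_ _ hd] _ k; rewrite hd; case: ltnP => [lt_k|ge_k].
  by rewrite nth_rev.
by rewrite nth_default // size_rev.
Qed.

Lemma rl_cmd_spec s A src dst :
    src != dst -> reg s 10 = size A -> size A + 2 < W ->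
    holds s src A -> blank s dst ->
  tri W s (rl_cmd src dst) (30 * size A + 20) (fun s' => holds_rl s' dst A).
Proof.
move=> ne es hW hA hB.
apply: (tri_for (hi := size A) (Phi := fun i => 30 * (size A - i))
  (I := fun i s1 => [/\ reg s1 11 = i, i <= size A &
     forall k, k <= i -> arr s1 dst k = rl A k])) => //; try lia.
- by split=> // k; rewrite leqn0 => /eqP -> /=; rewrite hB /rl take0.
- by move=> i s1 [].
- move=> i s1 [ei _ hd] fr lt_i; exists i.+1; eexists; split.
    have hAi : holds s1 src A by carry fr.
    apply: wp_tri => /=; rewrite ei !hAi hd // subn1.
    have := rlS 0 lt_i; have := rl_le A i.+1; have := rl_le A i.
    set b := (_ == _); move=> h1 h2 h3.
    have b1 : nat_of_bool b <= 1 by case: b {h3}.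
    have h4 : rl A i * b <= rl A i by case: b b1 {h3} => // _; lia.
    words; split=> //=; first by rewrite addn1.
    move=> k /=; rewrite eqxx /=; case: eqP => [->|nk].
      by rewrite addn1 h3 addn1.
    by move=> le_k; apply: hd; lia.
  by rewrite /=; lia.
by move=> s1 [_ _ hd] _.
Qed.

Lemma index_lt m n i j : i <= m -> j <= n -> i * n.+1 + j < m.+2 * n.+2.
Proof. nia. Qed.

(** Row-major addresses do not collide, so storing one cell preserves the others. *)
Lemma index_inj n i j i' j' : j <= n -> j' <= n ->
  (i * n.+1 + j == i' * n.+1 + j') = (i == i') && (j == j').
Proof.
move=> hj hj'; apply/eqP/andP => [e|[/eqP -> /eqP ->] //].
suff ei : i = i' by split; apply/eqP; lia.
nia.
Qed.

(** All cells read lie strictly before [(i, j)], so the query also serves while the table is being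
    filled. If [i] or [j] is 0, a run length is 0 and [(i, j)] itself may be read; this occurs only
    in queries to a complete table. *)
Lemma qry_spec s A B a b rla rlb t i j :
    (size A).+2 * (size B).+2 < W -> i <= size A -> j <= size B ->
    reg s 16 = i -> reg s 17 = j -> reg s 14 = (size B).+1 ->
    holds s a A -> holds s b B -> holds_rl s rla A -> holds_rl s rlb B ->
    (forall i' j', i' <= i -> j' <= j -> (i' + j' < i + j) || (i * j == 0) ->
       bd 0 A i' || bd 0 B j' -> lcs_cell s t A B i' j') ->
  tri W s (qry_cmd a b rla rlb t) 100 (fun s' => reg s' 19 = plcs A B i j).
Proof.
move=> hW ia jb ei ej eS hA hB hrA hrB cells.
have ri := rl_le A i; have rj := rl_le B j.
have ri0 : i * j == 0 \/ 0 < rl A i /\ 0 < rl B j.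
  case: (posnP i) => [->|i0]; first by left.
  case: (posnP j) => [->|j0]; first by left; rewrite muln0.
  by right; rewrite !rl_gt0 ?i0 ?j0.
have bi := rl_bd 0 ia; have bj := rl_bd 0 jb.
have Wi i' j' : i' <= i -> j' <= j -> i' * (size B).+1 + j' < W.
  move=> *; apply: ltn_trans hW; apply: index_lt; lia.
have Wi' i' : i' <= i -> i' * (size B).+1 < W.
  by move=> h; have := Wi i' 0 h isT; rewrite addn0.
have Wsmall k : k <= size A + size B + 1 -> k < W by move=> h; nia.
have [e|ne] := eqVneq (nth 0 A i.-1) (nth 0 B j.-1).
- have dW d : d <= i -> plcs A B (i - d) (j - d) + d < W.
    by move=> di; have := plcs_le A B (i - d) (j - d) => h; apply: Wsmall; lia.
  apply: wp_post => //; rewrite /= ei ej eS (hA _) (hB _) (hrA _) // (hrB _) //.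
  rewrite !subn1 e eqxx /=.
  do 6 (split; first by apply: Wsmall; lia).
  case: ltnP => hr /=.
  + have -> : lcs_cell s t A B (i - rl B j) (j - rl B j).
      by apply: cells; rewrite ?bj ?orbT //; lia.
    do 5 (split; first by first [apply: Wsmall; lia|apply: Wi'; lia
                                |apply: Wi; lia|apply: dW; lia]).
    by rewrite -(plcs_diag ia jb e) ?(ltnW hr).
  have -> : lcs_cell s t A B (i - rl A i) (j - rl A i).
    by apply: cells; rewrite ?bi //; lia.
  do 5 (split; first by first [apply: Wsmall; lia|apply: Wi'; lia
                              |apply: Wi; lia|apply: dW; lia]).
  by rewrite -(plcs_diag ia jb e).
have c1 : lcs_cell s t A B (i - rl A i) j.
  by apply: cells; rewrite ?bi //; lia.
have c2 : lcs_cell s t A B i (j - rl B j).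
  by apply: cells; rewrite ?bj ?orbT //; lia.
have eQ := plcs_block ia jb ne.
apply: wp_post => //; rewrite /= ei ej eS (hA _) (hB _) (hrA _) // (hrB _) //.
rewrite !subn1 (negbTE ne) c1 c2 /=.
do 12 (split; first by first [apply: Wsmall; lia|apply: Wi'; lia
                             |apply: Wi; lia]).
by rewrite eQ; case: ltnP => h /=; lia.
Qed.

Lemma nextb_rlE s a (A : seq nat) j : holds_rl s a (rev A) -> j <= size A ->
  j + arr s a (size A - j) = nextb A j.
Proof. by move=> h le_j; rewrite h ?size_rev ?leq_subr // nextb_rl_rev. Qed.

(** Progress in row-major order, with column [j] of row [i] included. Column 0 is correct from the
    start, being zero. *)
Definition lcs_done s t (A B : seq nat) i j :=
  forall i' j', i' <= size A -> j' <= size B ->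
    [|| j' == 0, i' < i | (i' == i) && (j' <= j)] ->
    bd 0 A i' || bd 0 B j' -> lcs_cell s t A B i' j'.

(** Time is charged to the visited columns: all of them in a boundary row, otherwise one per run of
    [B]. *)
Lemma lcs_row_cmd_spec s (A B : seq nat) a b rla rlb rlrb t i :
    (size A).+2 * (size B).+2 < W -> i < size A ->
    reg s 12 = size B -> reg s 14 = (size B).+1 ->
    reg s 15 = bd 0 A i.+1 -> reg s 16 = i.+1 ->
    holds s a A -> holds s b B -> holds_rl s rla A -> holds_rl s rlb B ->
    holds_rl s rlrb (rev B) ->
    a != t -> b != t -> rla != t -> rlb != t -> rlrb != t ->
    lcs_done s t A B i (size B) ->
  tri W s (lcs_row_cmd a b rla rlb rlrb t)
    (140 * (if bd 0 A i.+1 then size B else size (rle B)) + 7)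
    (fun s' => lcs_done s' t A B i.+1 (size B)).
Proof.
move=> hW ia e12 e14 e15 e16 hA hB hrA hrB hrrB na nb nra nrb nrrb done0.
have Wsmall k : k <= size A + size B + 1 -> k < W by move=> h; nia.
apply: (tri_for (hi := size B)
  (Phi := fun j => 140 * (if bd 0 A i.+1 then size B - j else size (rle (drop j B))))
  (I := fun j s1 => [/\ reg s1 13 = j, j <= size B & lcs_done s1 t A B i.+1 j])) => //.
- by apply: Wsmall; lia.
- split=> // i' j' hi hj c; apply: done0 => //; lia.
- by move=> j s1 [].
- move=> j s1 [ej _ done1] fr lt_j; carry fr.
  have [jn ejn] : exists jn, jn = if bd 0 A i.+1 then j.+1 else nextb B j by eexists.
  have hd0 := nextb_gt lt_j; have hd1 : nextb B j <= size B := nextb_le (ltnW lt_j).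
  have lt_jn : j < jn <= size B by rewrite ejn; case: ifP => _; lia.
  (* Columns strictly between [j] and [jn] occur only in a non-boundary row and are no boundaries
     themselves, so no cell is owed there. *)
  have prev i' j' : i' <= size A -> j' <= size B ->
      [|| j' == 0, i' < i.+1 | (i' == i.+1) && (j' < jn)] ->
      bd 0 A i' || bd 0 B j' -> lcs_cell s1 t A B i' j'.
    move=> hi hj c bij; apply: done1 => //.
    case/or3P: c => [-> //|->|/andP [/eqP ei lt_j']]; rewrite ?orbT // ei eqxx ltnn /=.
    apply/orP; right; rewrite leqNgt; apply/negP => gt_j'.
    move: lt_j' bij; rewrite ejn ei; case: ifP => [_|_ lt_j' /=]; first by lia.
    by apply/negP/(@before_nextb _ 0 B j); lia.
  exists jn; eexists; split.
    apply: (tri_seq (Q1 := fun s2 => reg s2 17 = jn)).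
      apply: wp_tri => /=; regs s1.
      rewrite ejn; case: (bd 0 A i.+1) => /=.
        by split; [apply: Wsmall; lia|split; [apply: Wsmall; lia|rewrite addn1]].
      rewrite nextb_rlE ?(ltnW lt_j) //.
      by split; [apply: Wsmall; lia|split; [apply: Wsmall; lia|]].
    move=> s2 e17 fr2; carry fr2.
    have prev2 i' j' : i' <= size A -> j' <= size B ->
        [|| j' == 0, i' < i.+1 | (i' == i.+1) && (j' < jn)] ->
        bd 0 A i' || bd 0 B j' -> lcs_cell s2 t A B i' j'.
      by rewrite /lcs_cell fr2.2 //; apply: prev.
    apply: tri_seq.
      apply: (@qry_spec s2 A B a b rla rlb t i.+1 jn) => //; first by lia.
      by move=> i' j' hi hj lt_ij; apply: prev2; lia.
    move=> s3 /= e19 fr3; carry fr3.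
    have prev3 i' j' : i' <= size A -> j' <= size B ->
        [|| j' == 0, i' < i.+1 | (i' == i.+1) && (j' < jn)] ->
        bd 0 A i' || bd 0 B j' -> lcs_cell s3 t A B i' j'.
      by rewrite /lcs_cell fr3.2 //; apply: prev2.
    apply: wp_tri => /=; regs s3.
    have hidx := @index_lt (size A) (size B) i.+1 jn.
    split; first by lia.
    split; first by lia.
    split=> //; first by lia.
    move=> i' j' hi hj c bij; rewrite /lcs_cell /= eqxx /= index_inj //; last by lia.
    case: eqP => [ei|ni] /=; last by apply: prev3 => //; lia.
    case: eqP => [ejn'|nj]; first by rewrite ei ejn'.
    by apply: prev3 => //; lia.
  rewrite /= ejn; case: (bd 0 A i.+1); first by lia.
  have -> : size (rle (drop j B)) = (size (rle (drop (nextb B j) B))).+1.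
    exact: size_rle_nextb.
  by move=> /=; lia.
- by rewrite drop0 subn0.
- by move=> s1 [].
Qed.

(** The first part of the potential pays for full boundary rows, the second for the sparse pass over
    any row. As [B] has at least one run, the second also covers the constant overhead per row. *)
Lemma lcs_cmd_spec s (A B : seq nat) a b rla rlra rlb rlrb t :
    (size A).+2 * (size B).+2 < W -> 0 < size B ->
    reg s 10 = size A -> reg s 12 = size B -> reg s 14 = (size B).+1 ->
    holds s a A -> holds s b B -> holds_rl s rla A -> holds_rl s rlb B ->
    holds_rl s rlra (rev A) -> holds_rl s rlrb (rev B) ->
    a != t -> b != t -> rla != t -> rlb != t -> rlra != t -> rlrb != t ->
    blank s t ->
  tri W s (lcs_cmd a b rla rlra rlb rlrb t)
    (200 * (size (rle A) * size B + size (rle B) * size A) + 7)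
    (fun s' => lcs_table s' t A B).
Proof.
move=> hW B0 e10 e12 e14 hA hB hrA hrB hrrA hrrB na nb nra nrb nrra nrrb bt.
have Wsmall k : k <= size A + size B + 1 -> k < W by move=> h; nia.
have n0 : 0 < size (rle B) by rewrite size_rle_hrun.
apply: (tri_for (hi := size A)
  (Phi := fun i => 200 * (size (rle (drop i A)) * size B + size (rle B) * (size A - i)))
  (I := fun i s1 => [/\ reg s1 11 = i, i <= size A & lcs_done s1 t A B i (size B)])) => //.
- by apply: Wsmall; lia.
- split=> // i' j' hi hj c _; rewrite /lcs_cell bt.
  case/or3P: c => [/eqP ->|//|/andP [/eqP -> _]]; rewrite ?plcs0r //.
  by rewrite plcs0l.
- by move=> i s1 [].
- move=> i s1 [ei _ done1] fr lt_i; carry fr.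
  exists i.+1; eexists; split.
    apply: (tri_seq (Q1 := fun s2 => reg s2 16 = i.+1)).
      by apply: wp_tri => /=; regs s1;
        rewrite addn1; do 2 (split; first by apply: Wsmall; lia).
    move=> s2 e16 fr2; carry fr2.
    apply: (tri_seq (Q1 := fun s3 => reg s3 15 = bd 0 A i.+1)).
      apply: wp_tri => /=; regs s2.
      have -> : arr s2 rlra (size A - i) = rl (rev A) (size A - i).
        by match goal with h : holds_rl s2 rlra _ |- _ => apply: h end;
           rewrite size_rev leq_subr.
      rewrite (bd_rl_rev 0 lt_i).
      by do 3 (split; first by apply: Wsmall; lia).
    move=> s3 e15 fr3; carry fr3.
    apply: tri_seq.
      apply: (@lcs_row_cmd_spec s3 A B a b rla rlb rlrb t i) => //.
      by move=> *; rewrite /lcs_cell fr3.2 // fr2.2 //; apply: done1.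
    move=> s4 done4 fr4; carry fr4.
    by apply: wp_tri => /=; regs s4.
  have -> : size (rle (drop i A)) = bd 0 A i.+1 + size (rle (drop i.+1 A)).
    exact: size_rle_drop.
  have -> : size A - i = (size A - i.+1).+1 by lia.
  move: (size (rle _)) (size A - i.+1) (size (rle B)) n0 => r p n n0 /=.
  by rewrite !mulnDl mulnS; case: (bd 0 A i.+1); lia.
- by rewrite drop0 subn0.
- by move=> s1 [_ _ h] _ i j hi hj; apply: h => //; lia.
Qed.

Lemma strip_val_cmd_spec s (A X : seq nat) h a x rla rlx g i j :
    (size A).+2 * h.+2 < W -> 0 < i <= size A -> j <= h -> h <= size X ->
    reg s 12 = h.+1 -> reg s 13 = j -> reg s 14 = i ->
    holds s a A -> holds s x X -> holds_rl s rla A -> holds_rl s rlx X ->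
    (forall j', j' <= h -> strip_cell s g A X h (i - rl A i) j') ->
  tri W s (strip_val_cmd a x rla rlx g) 100 (fun s' => reg s' 16 = pstrip A X i j).
Proof.
move=> hW /andP [i0 ia] jh hX e12 e13 e14 hA hX' hrA hrX cells.
have ri := rl_le A i; have rj := rl_le X j.
have Wsmall k : k <= size A + h + 1 -> k < W by move=> hk; nia.
have Wi j' : j' <= h -> (i - rl A i) * h.+1 + j' < W.
  by move=> hj; apply: ltn_trans hW; apply: index_lt; lia.
have Wi' : (i - rl A i) * h.+1 < W by have := Wi 0 isT; rewrite addn0.
have jX : j <= size X by lia.
apply: wp_post => //; rewrite /= e12 e13 e14 (hA _) (hX' _) (hrA _) // (hrX _) //.
rewrite !subn1 /=.
do 2 (split; first by apply: Wsmall; lia).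
case: (eqVneq j 0) => /= [->|j0].
  do 2 (split; first by apply: Wsmall; lia).
  by rewrite pstrip0r // addn1.
do 5 (split; first by apply: Wsmall; lia).
have jX0 : 0 < j <= size X by lia.
have -> := @pstrip_run _ 0 A X i j ia jX0.
case: (eqVneq (nth 0 A i.-1) (nth 0 X j.-1)) => /= _; last first.
  split; first by apply: Wsmall; lia.
  split; first by [].
  split; first exact: Wi.
  exact: cells.
split; first by apply: Wsmall; lia.
case: (ltnP (rl X j) (rl A i)) => hr /=.
  split; first by apply: Wsmall; lia.
  case: (eqVneq j (rl X j)) => /= _.
    by do 3 (split; first by apply: Wsmall; lia); rewrite addn1.
  split; first by apply: Wsmall; lia.
  split; first by [].
  split; first by apply: Wsmall; lia.
  split; first by apply: Wi; lia.
  by apply: cells; lia.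
split; first by apply: Wsmall; lia.
case: (eqVneq j (rl A i)) => /= _.
  by do 3 (split; first by apply: Wsmall; lia); rewrite addn1.
split; first by apply: Wsmall; lia.
split; first by [].
split; first by apply: Wsmall; lia.
split; first by apply: Wi; lia.
by apply: cells; lia.
Qed.

(** Column [j] of row [i] is excluded, so a complete row has [j = h.+1]. *)
Definition strip_done s g (A X : seq nat) h i j :=
  forall i' j', i' <= size A -> j' <= h -> bd 0 A i' ->
    (i' < i) || ((i' == i) && (j' < j)) -> strip_cell s g A X h i' j'.

Lemma strip_row_cmd_spec s (A X : seq nat) h a x rla rlx g i :
    (size A).+2 * h.+2 < W -> 0 < i <= size A -> h <= size X ->
    reg s 12 = h.+1 -> reg s 14 = i ->
    holds s a A -> holds s x X -> holds_rl s rla A -> holds_rl s rlx X ->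
    a != g -> x != g -> rla != g -> rlx != g ->
    strip_done s g A X h i 0 ->
  tri W s (strip_row_cmd a x rla rlx g) (140 * h.+1 + 7)
    (fun s' => strip_done s' g A X h i h.+1).
Proof.
move=> hW i0a hX e12 e14 hA hX' hrA hrX na nx nra nrx done0.
have /andP [i0 ia] := i0a.
have ri := rl_le A i.
have ri0 : 0 < rl A i := rl_gt0 i0a.
have Wsmall k : k <= size A + h + 1 -> k < W by move=> hk; nia.
apply: (tri_for (hi := h.+1) (Phi := fun j => 140 * (h.+1 - j))
  (I := fun j s1 => [/\ reg s1 13 = j, j <= h.+1 & strip_done s1 g A X h i j])) => //.
- by apply: Wsmall; lia.
- by move=> j s1 [].
- move=> j s1 [ej _ done1] fr lt_j; carry fr.
  exists j.+1; eexists; split.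
    apply: tri_seq.
      apply: (@strip_val_cmd_spec s1 A X h a x rla rlx g i j) => // j' hj'.
      by apply: done1 => //; [lia|exact: rl_bd|lia].
    move=> s2 /= e16 fr2; carry fr2.
    apply: wp_tri => /=; regs s2.
    have hidx : i * h.+1 + j < (size A).+2 * h.+2 by apply: index_lt.
    split; first by lia.
    split; first by lia.
    split; first by apply: Wsmall; lia.
    split; first by apply: Wsmall; lia.
    split=> //; first by rewrite addn1.
    move=> i' j' hi hj bi c; rewrite /strip_cell /= eqxx /= index_inj //.
    case: eqP => [ei|ni] /=.
      case: eqP => [ej'|nj]; first by rewrite ei ej'.
      by rewrite fr2.2 //; apply: done1 => //; lia.
    by rewrite fr2.2 //; apply: done1 => //; lia.
  by rewrite /=; lia.
by move=> s1 [].
Qed.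

(** One row of [h.+1] entries is computed per run of [A], each entry in constant time. *)
Lemma strip_cmd_spec s (A X : seq nat) h a x rla rlra rlx g :
    (size A).+2 * h.+2 < W -> h <= size X ->
    reg s 10 = size A -> reg s 12 = h.+1 ->
    holds s a A -> holds s x X -> holds_rl s rla A -> holds_rl s rlra (rev A) ->
    holds_rl s rlx X ->
    a != g -> x != g -> rla != g -> rlra != g -> rlx != g -> blank s g ->
  tri W s (strip_cmd a x rla rlra rlx g) (200 * (size (rle A) * h.+1) + 20)
    (fun s' => strip_table s' g A X h).
Proof.
move=> hW hX e10 e12 hA hX' hrA hrrA hrX na nx nra nrra nrx bg.
have Wsmall k : k <= size A + h + 1 -> k < W by move=> hk; nia.
apply: tri_weaken.
- apply: (tri_seq (Q1 := fun s1 => strip_done s1 g A X h 0 h.+1)).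
    apply: wp_tri => /=; do 2 (split; first by apply: Wsmall; lia).
    move=> i j hi hj _ c; have -> : i = 0 by lia.
    rewrite /strip_cell mul0n add0n /= eqxx /=.
    case: eqP => [->|nj]; first by rewrite pstrip0r.
    by rewrite bg pstrip0l //=; lia.
  move=> s0 done0 fr0; carry fr0.
  apply: (tri_for (hi := size A) (T := 200 * (size (rle A) * h.+1) + 7)
    (Phi := fun i => 200 * (size (rle (drop i A)) * h.+1))
    (I := fun i s1 => [/\ reg s1 11 = i, i <= size A & strip_done s1 g A X h i h.+1])
    (Q := fun s1 => strip_done s1 g A X h (size A) h.+1)) => //.
  + by apply: Wsmall; lia.
  + by move=> i s1 [].
  + move=> i s1 [ei _ done1] fr lt_i; carry fr.
    have gt_n : i < nextb A i := nextb_gt lt_i.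
    have le_n : nextb A i <= size A := nextb_le (ltnW lt_i).
    exists (nextb A i); eexists; split.
      apply: (tri_seq (Q1 := fun s2 => reg s2 14 = nextb A i)).
        apply: wp_tri => /=; regs s1; rewrite nextb_rlE ?(ltnW lt_i) //.
        by do 2 (split; first by apply: Wsmall; lia).
      move=> s2 e14 fr2; carry fr2.
      apply: tri_seq.
        apply: (@strip_row_cmd_spec s2 A X h a x rla rlx g (nextb A i)) => //.
          by lia.
        move=> i' j' hi hj bi c; rewrite /strip_cell fr2.2 //; apply: done1 => //.
        have [|gt_i] := leqP i' i; first by lia.
        by have := @before_nextb _ 0 A i i'; rewrite bi; lia.
      move=> s3 done3 fr3; carry fr3.
      by apply: wp_tri => /=; regs s3.
    have -> : size (rle (drop i A)) = (size (rle (drop (nextb A i) A))).+1.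
      exact: size_rle_nextb.
    by rewrite /= mulSn; lia.
  + by rewrite drop0.
  by move=> s1 [].
- by rewrite /=; lia.
by move=> s1 done1 _ i j hi hj bi; apply: done1 => //; lia.
Qed.

End Programs.

(** * Evaluating and maximising the candidates *)

Definition load_cmd :=
  22 :<- Get 12 ($20 * $5 + $4) ;;
  23 :<- Get 13 ($21 * $5 + $4) ;;
  24 :<- Get 14 (($0 - $20) * $6 + ($2 - $4)) ;;
  25 :<- Get 15 (($1 - $21) * $6 + ($2 - $4)).

Definition sum_cmd :=
  (16 :<- $22 - #1 ;; 17 :<- $23 - #1) ;;
  qry_cmd 0 1 6 7 16 ;;
  (26 :<- $19 + $2 ;; 16 :<- $24 - #1 ;; 17 :<- $25 - #1) ;;
  qry_cmd 3 4 9 10 17 ;;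
  26 :<- $19 + $26.

Definition cand_cmd :=
  load_cmd ;;
  If ((#0 < $22) * ((#0 < $23) * ((#0 < $24) * (#0 < $25))))
    sum_cmd (26 :<- #0).

Definition best_row_cmd :=
  For 21 1
    (cand_cmd ;;
     (If ($3 < $26) (3 :<- $26) Skip ;;
      21 :<- $21 + Get 10 ($1 - $21))).

Definition best_cmd :=
  3 :<- #0 ;;
  For 20 0 (best_row_cmd ;; 20 :<- $20 + Get 9 ($0 - $20)).

(** Everything the candidate search reads, bundled so that [ready_frame] carries it across commands
    at once. *)
Record ready s (A B C : seq nat) h : Prop := Ready {
  ready0 : reg s 0 = size A;
  ready1 : reg s 1 = size B;
  ready2 : reg s 2 = size C;
  ready4 : reg s 4 = h;
  ready5 : reg s 5 = h.+1;
  ready6 : reg s 6 = (size C - h).+1;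
  ready14 : reg s 14 = (size B).+1;
  ready_A : holds s 0 A;
  ready_B : holds s 1 B;
  ready_rA : holds s 3 (rev A);
  ready_rB : holds s 4 (rev B);
  ready_lA : holds_rl s 6 A;
  ready_lB : holds_rl s 7 B;
  ready_lrA : holds_rl s 9 (rev A);
  ready_lrB : holds_rl s 10 (rev B);
  ready_sA : strip_table s 12 A C h;
  ready_sB : strip_table s 13 B C h;
  ready_srA : strip_table s 14 (rev A) (rev C) (size C - h);
  ready_srB : strip_table s 15 (rev B) (rev C) (size C - h);
  ready_T : lcs_table s 16 A B;
  ready_rT : lcs_table s 17 (rev A) (rev B) }.

Lemma ready_frame c s s' A B C h : frame c s s' ->
  all (fun x => x \notin wregs c) [:: 0; 1; 2; 4; 5; 6; 14] ->
  all (fun a => a \notin warrs c) (iota 0 18) ->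
  ready s A B C h -> ready s' A B C h.
Proof.
move=> fr /allP rc /allP ac rd.
have er x : x \in [:: 0; 1; 2; 4; 5; 6; 14] -> reg s' x = reg s x.
  by move=> /rc; apply: fr.1.
have ea a : a \in iota 0 18 -> arr s' a = arr s a by move=> /ac; apply: fr.2.
by case: rd => *; split; rewrite /holds /holds_rl /strip_table /strip_cell
  /lcs_table /lcs_cell ?er ?ea.
Qed.

Section Best.

Variables (W : nat) (A B C : seq nat) (h : nat).
Hypotheses (hW : (size A).+2 * (size B).+2 < W) (hh : 0 < h < size C).
Hypotheses (CA : size C <= size A) (CB : size C <= size B).

(** The bound is chosen for candidate values: two LCS lengths of at most [size A] each, plus
    [size C <= size B]. *)
Lemma small_word k : k <= 2 * size A + size B + 2 -> k < W.
Proof. by move=> hk; nia. Qed.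

Lemma index_word_A i j k : i <= size A -> j <= k -> k <= size B ->
  i * k.+1 < W /\ i * k.+1 + j < W.
Proof.
move=> hi hj hk; suff h1 : i * k.+1 + j < W by split=> //; lia.
apply: leq_ltn_trans hW.
have : i * k.+1 <= size A * (size B).+1 by apply: leq_mul.
lia.
Qed.

Lemma index_word_B i j k : i <= size B -> j <= k -> k <= size A ->
  i * k.+1 < W /\ i * k.+1 + j < W.
Proof.
move=> hi hj hk; suff h1 : i * k.+1 + j < W by split=> //; lia.
apply: leq_ltn_trans hW.
have : i * k.+1 <= size B * (size A).+1 by apply: leq_mul.
lia.
Qed.

Lemma cand_cmd_spec s u v : ready s A B C h ->
    u < size A -> bd 0 A u -> v < size B -> bd 0 B v ->
    reg s 20 = u -> reg s 21 = v ->
  tri W s cand_cmd 400 (fun s' => reg s' 26 = cand A B C h u v).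
Proof.
move=> rd ua bu vb bv e20 e21.
(* The suffix tables are read in rows [size A - u] and [size B - v], which must be boundaries of the
   reversed strings. *)
have bu' := bd_rev (ltnW ua) bu; have bv' := bd_rev (ltnW vb) bv.
pose x := pstrip A C u h; pose y := pstrip B C v h.
pose x' := pstrip (rev A) (rev C) (size A - u) (size C - h).
pose y' := pstrip (rev B) (rev C) (size B - v) (size C - h).
have ax : x <= u.+1 := pstrip_le C h (ltnW ua).
have ay : y <= v.+1 := pstrip_le C h (ltnW vb).
have ax' : x' <= (size A - u).+1 by apply: pstrip_le; rewrite size_rev leq_subr.
have ay' : y' <= (size B - v).+1 by apply: pstrip_le; rewrite size_rev leq_subr.
apply: tri_weaken.
- apply: (tri_seq (Q1 := fun s1 =>
    [/\ reg s1 22 = x, reg s1 23 = y, reg s1 24 = x' & reg s1 25 = y'])).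
    apply: wp_tri; have [r0 r1 r2 r4 r5 r6 _ _ _ _ _ _ _ _ _ sA sB srA srB _ _] := rd.
    rewrite /= e20 e21 r0 r1 r2 r4 r5 r6.
    have [i1 i1'] : u * h.+1 < W /\ u * h.+1 + h < W by apply: index_word_A; lia.
    have [i2 i2'] : v * h.+1 < W /\ v * h.+1 + h < W by apply: index_word_B; lia.
    have [i3 i3'] := @index_word_A (size A - u) (size C - h) (size C - h)
      (leq_subr _ _) (leqnn _) (leq_trans (leq_subr _ _) CB).
    have [i4 i4'] := @index_word_B (size B - v) (size C - h) (size C - h)
      (leq_subr _ _) (leqnn _) (leq_trans (leq_subr _ _) CA).
    do 12 (split; first by first [assumption | apply: small_word; lia]).
    split.
    + by apply: sA => //; lia.
    + by apply: sB => //; lia.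
    + by apply: srA; rewrite ?size_rev //; lia.
    + by apply: srB; rewrite ?size_rev //; lia.
  move=> s1 [e22 e23 e24 e25] fr1; have rd1 := ready_frame fr1 isT isT rd.
  apply: (tri_if (T := 300)
    (Q := fun s2 => reg s2 26 = cand A B C h u v)) => /=; rewrite e22 e23 e24 e25.
  have Wb (b : bool) : b < W by apply: small_word; case: b; lia.
  rewrite !mulnb; do 11 (split; first by first [exact: Wb | apply: small_word; lia]).
  rewrite eqb0 negbK /cand -/x -/y -/x' -/y'; 
  case xy: [&& 0 < x, 0 < y, 0 < x' & 0 < y'] => /=; last first.
    apply: (wp_post (c := 26 :<- #0)) => //=.
    by split=> //; apply: small_word; lia.
  have /and4P [x0 y0 x0' y0'] := xy.
  have rT : plcs A B x.-1 y.-1 <= size A := plcs_le_size _ _ _ _.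
  have rT' : plcs (rev A) (rev B) x'.-1 y'.-1 <= size A.
    by rewrite -(size_rev A) plcs_le_size.
  apply: tri_weaken.
  + apply: (tri_seq (Q1 := fun s2 => reg s2 16 = x.-1 /\ reg s2 17 = y.-1)).
      apply: wp_tri => /=; rewrite e22 e23 !subn1.
      by do 4 (split; first by apply: small_word; lia).
    move=> s2 [e16 e17] fr2; carry fr2; have rd2 := ready_frame fr2 isT isT rd1.
    apply: tri_seq.
      have [_ _ _ _ _ _ r14 hA hB _ _ lA lB _ _ _ _ _ _ hT _] := rd2.
      apply: (@qry_spec W s2 A B 0 1 6 7 16 x.-1 y.-1) => //; try lia.
      by move=> i j hi hj _ bij; apply: hT => //; lia.
    move=> s3 /= e19 fr3; carry fr3; have rd3 := ready_frame fr3 isT isT rd2.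
    apply: (tri_seq (Q1 := fun s4 => [/\ reg s4 26 = plcs A B x.-1 y.-1 + size C,
        reg s4 16 = x'.-1 & reg s4 17 = y'.-1])).
      apply: wp_tri => /=; regs s3; rewrite (ready2 rd3) !subn1.
      by do 5 (split; first by apply: small_word; lia).
    move=> s4 [e26 e16' e17'] fr4; carry fr4; have rd4 := ready_frame fr4 isT isT rd3.
    apply: tri_seq.
      have [_ _ _ _ _ _ r14 _ _ hA hB _ _ lA lB _ _ _ _ _ hT] := rd4.
      apply: (@qry_spec W s4 (rev A) (rev B) 3 4 9 10 17 x'.-1 y'.-1) => //;
        rewrite ?size_rev //; try lia.
      by move=> i j hi hj _ bij; apply: hT; rewrite ?size_rev //; lia.
    move=> s5 /= e19' fr5; carry fr5.
    apply: (wp_tri (Q := fun s6 => reg s6 26 =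
      plcs A B x.-1 y.-1 + plcs (rev A) (rev B) x'.-1 y'.-1 + size C)) => /=.
    by regs s5; split; [apply: small_word; lia|lia].
  + by [].
  by [].
- by [].
by [].
Qed.

(** 0 is both the initial maximum and the value of a failed candidate. *)
Definition attained r := r = 0 \/ exists2 Z, str_ic_cs A B C Z & size Z = r.

(** The pairs precede [(u, v)] in the lexicographic order in which the two loops visit them. *)
Definition covered r u v := forall u' v',
  u' < size A -> bd 0 A u' -> v' < size B -> bd 0 B v' ->
  (u' < u) || ((u' == u) && (v' < v)) -> cand A B C h u' v' <= r.

Lemma attained_cand u v : u < size A -> v < size B -> attained (cand A B C h u v).
Proof.
move=> ua vb; have [->|c0] := posnP (cand A B C h u v); first by left.
by right; apply: cand_sound => //=; lia.
Qed.

(** Completeness of the candidates makes [r] an upper bound, and [attained] gives a witness. If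
    [r = 0], no feasible string exists, as it would contain the nonempty [C]. *)
Lemma covered_answer r : nth 0 C h != nth 0 C h.-1 ->
  attained r -> covered r (size A) 0 -> str_ic_lcs_answer A B C r.
Proof.
move=> ne att cov.
have le_r Z : str_ic_cs A B C Z -> size Z <= r.
  move=> /(cand_complete hh ne) [u [v [ua bu vb bv le_c]]].
  apply: leq_trans le_c _; apply: cov => //.
  by apply/orP; left.
case: att => [r0|[Z cZ e]].
  right; split=> // Z cZ; have := le_r _ cZ; case: cZ => /size_infix.
  by rewrite r0 /=; lia.
by left; exists Z => //; split=> // Z' /le_r; rewrite e.
Qed.

Lemma best_row_cmd_spec s u : ready s A B C h -> u < size A -> bd 0 A u ->
    reg s 20 = u -> attained (reg s 3) -> covered (reg s 3) u 0 ->
  tri W s best_row_cmd (500 * size (rle B) + 7)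
    (fun s' => attained (reg s' 3) /\ covered (reg s' 3) u (size B)).
Proof.
move=> rd ua bu e20 att cov.
apply: (tri_for (hi := size B) (Phi := fun v => 500 * size (rle (drop v B)))
  (I := fun v s1 => [/\ reg s1 21 = v, v <= size B, v < size B -> bd 0 B v,
     attained (reg s1 3) & covered (reg s1 3) u v])) => //.
- by apply: small_word; lia.
- exact: ready1 rd.
- by move=> v s1 [].
- move=> v s1 [e21 _ bv att1 cov1] fr lt_v; carry fr.
  have rd1 := ready_frame fr isT isT rd.
  have gt_n : v < nextb B v := nextb_gt lt_v.
  have le_n : nextb B v <= size B := nextb_le (ltnW lt_v).
  exists (nextb B v); eexists; split.
    apply: tri_seq.
      by apply: (@cand_cmd_spec s1 u v) => //; apply: bv.
    move=> s2 /= e26 fr2; carry fr2; have rd2 := ready_frame fr2 isT isT rd1.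
    have e3 : reg s2 3 = reg s1 3 by apply: fr2.1.
    (* The only boundary pair added by moving from [v] to [nextb B v] is [(u, v)]. *)
    have cov2 r : reg s1 3 <= r -> cand A B C h u v <= r -> covered r u (nextb B v).
      move=> le_r le_c u' v' u'a bu' v'b bv' c.
      have [/andP [/eqP -> /eqP ->] //|ne] := boolP ((u' == u) && (v' == v)).
      apply: leq_trans le_r; apply: cov1 => //.
      case/orP: c => [-> //|/andP [/eqP eu lt_v']]; rewrite eu eqxx ltnn /=.
      rewrite ltnNge; apply/negP => le_v'.
      have := @before_nextb _ 0 B v v'; rewrite bv'; rewrite eu eqxx in ne.
      by move/(_ _)/negP; apply; [lia|].
    apply: wp_tri => /=; regs s2.
    split; first by apply: small_word; case: (_ < _); lia.
    have hn := nextb_rlE (ready_lrB rd2) (ltnW lt_v).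
    case: ltnP => hc /=; regs s2; rewrite (ready1 rd2) hn.
      do 2 (split; first by apply: small_word; lia).
      split=> //; first by move=> ?; apply: nextb_bd.
        exact: attained_cand.
      by apply: cov2 => //; apply: ltnW.
    do 2 (split; first by apply: small_word; lia).
    split=> //; first by move=> ?; apply: nextb_bd.
    exact: cov2.
  have -> : size (rle (drop v B)) = (size (rle (drop (nextb B v) B))).+1.
    exact: size_rle_nextb.
  by move=> /=; lia.
- by rewrite drop0.
by move=> s1 [].
Qed.

Lemma best_cmd_spec s : ready s A B C h -> nth 0 C h != nth 0 C h.-1 ->
  tri W s best_cmd (600 * (size (rle A) * size (rle B)) + 20)
    (fun s' => str_ic_lcs_answer A B C (reg s' 3)).
Proof.
move=> rd ne; have n0 : 0 < size (rle B) by rewrite size_rle_hrun //=; lia.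
apply: tri_weaken.
- apply: (tri_seq (Q1 := fun s1 => reg s1 3 = 0)).
    by apply: wp_tri => /=; split=> //; apply: small_word; lia.
  move=> s0 e3 fr0; have rd0 := ready_frame fr0 isT isT rd.
  apply: (tri_for (hi := size A)
    (T := 600 * (size (rle A) * size (rle B)) + 7)
    (Phi := fun u => 600 * (size (rle (drop u A)) * size (rle B)))
    (I := fun u s1 => [/\ reg s1 20 = u, u <= size A, u < size A -> bd 0 A u,
       attained (reg s1 3) & covered (reg s1 3) u 0])
    (Q := fun s1 => str_ic_lcs_answer A B C (reg s1 3))) => //.
  + by apply: small_word; lia.
  + exact: ready0 rd0.
  + split=> //=; first by left.
    by move=> u v _ _ _ _; rewrite !ltn0 andbF.
  + by move=> u s1 [].
  + move=> u s1 [e20 _ bu att1 cov1] fr lt_u.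
    have rd1 := ready_frame fr isT isT rd0.
    have gt_n : u < nextb A u := nextb_gt lt_u.
    have le_n : nextb A u <= size A := nextb_le (ltnW lt_u).
    exists (nextb A u); eexists; split.
      apply: tri_seq.
        by apply: (@best_row_cmd_spec s1 u) => //; apply: bu.
      move=> s2 [att2 cov2] fr2; carry fr2.
      have rd2 := ready_frame fr2 isT isT rd1.
      have hn := nextb_rlE (ready_lrA rd2) (ltnW lt_u).
      apply: wp_tri => /=; regs s2; rewrite (ready0 rd2) hn.
      do 2 (split; first by apply: small_word; lia).
      split=> //; first by move=> ?; apply: nextb_bd.
      move=> u' v' u'a bu' v'b bv' c; apply: cov2 => //.
      rewrite v'b andbT; rewrite ltn0 andbF orbF in c.
      have [|gt_u] := leqP u' u; first by lia.
      by have := @before_nextb _ 0 A u u'; rewrite bu'; lia.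
    have -> : size (rle (drop u A)) = (size (rle (drop (nextb A u) A))).+1.
      exact: size_rle_nextb.
    move: (size (rle (drop _ A))) (size (rle B)) n0 => r n n0 /=; lia.
  + by rewrite drop0.
  by move=> s1 [_ _ _ att cov] _; apply: covered_answer.
- by rewrite /=; lia.
by [].
Qed.

End Best.

(** * The complete program and its running time *)

Definition prep_cmd l src r rls rlr :=
  10 :<- $l ;; rev_cmd src r ;; rl_cmd src rls ;; rl_cmd r rlr.

(* Arrays: 3-5 reversed strings; 6-8 and 9-11 run lengths [rl] of the strings
   and of the reversed strings; 12-15 matchings in A, B, rev A, rev B; 16 and 17
   LCS of prefixes and of suffixes.  Registers 4, 5, 6: h, h + 1, |C| - h + 1,
   where h is the length of the first run of C. *)
Definition main_cmd :=
  prep_cmd 0 0 3 6 9 ;;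
  prep_cmd 1 1 4 7 10 ;;
  prep_cmd 2 2 5 8 11 ;;
  (4 :<- Get 11 $2 ;; 5 :<- $4 + #1 ;; 6 :<- $2 - $4 + #1) ;;
  (10 :<- $0 ;; 12 :<- $5) ;; strip_cmd 0 2 6 9 8 12 ;;
  12 :<- $6 ;; strip_cmd 3 5 9 6 11 14 ;;
  (10 :<- $1 ;; 12 :<- $5) ;; strip_cmd 1 2 7 10 8 13 ;;
  12 :<- $6 ;; strip_cmd 4 5 10 7 11 15 ;;
  (10 :<- $0 ;; 12 :<- $1 ;; 14 :<- $1 + #1) ;;
  lcs_cmd 0 1 6 9 7 10 16 ;;
  lcs_cmd 3 4 9 6 10 7 17 ;;
  best_cmd.

Lemma prep_cmd_spec W s (A : seq nat) l src r rls rlr :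
    reg s l = size A -> size A + 2 < W -> holds s src A ->
    blank s r -> blank s rls -> blank s rlr ->
    src != r -> src != rls -> r != rls -> r != rlr -> rlr != r -> rlr != rls ->
    rls != r -> rls != rlr ->
  tri W s (prep_cmd l src r rls rlr) (100 * size A + 100)
    (fun s' => [/\ holds s' r (rev A), holds_rl s' rls A & holds_rl s' rlr (rev A)]).
Proof.
move=> el hW hA br bs bt n1 n2 n3 n4 n5 n6 n7 n8; apply: (tri_weaken (Q := fun s' =>
  [/\ holds s' r (rev A), holds_rl s' rls A & holds_rl s' rlr (rev A)])).
- apply: (tri_seq (Q1 := fun s1 => reg s1 10 = size A)); first exact: wp_tri.
  move=> s1 /= e10 fr1; carry fr1.
  apply: tri_seq; first by apply: rev_cmd_spec; eassumption.
  move=> s2 /= hr fr2; carry fr2.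
  apply: tri_seq; first by apply: (@rl_cmd_spec W s2 A src rls).
  move=> s3 /= hs fr3; carry fr3.
  have ht : tri W s3 (rl_cmd r rlr) (30 * size (rev A) + 20)
      (fun s' => holds_rl s' rlr (rev A)) by apply: rl_cmd_spec; rewrite ?size_rev.
  apply: tri_weaken ht (leqnn _) _.
  by move=> s4 /= ht fr4; carry fr4; split.
- by rewrite /= size_rev; lia.
by [].
Qed.

Section Main.

Variables (W : nat) (A B C : seq nat).
Hypotheses (hW : (size A).+2 * (size B).+2 < W).
Hypotheses (CA : size C <= size A) (CB : size C <= size B).
Hypothesis rC : 1 < size (rle C).

Lemma main_cmd_spec s :
    reg s 0 = size A -> reg s 1 = size B -> reg s 2 = size C ->
    holds s 0 A -> holds s 1 B -> holds s 2 C ->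
    (forall a, 2 < a -> blank s a) ->
  tri W s main_cmd
    (4000 * (size (rle A) * size B + size (rle B) * size A))
    (fun s' => str_ic_lcs_answer A B C (reg s' 3)).
Proof.
move=> e0 e1 e2 hA hB hC bl.
have C0 : 0 < size C by move: rC; case: (C).
have B0 : 0 < size B by apply: leq_trans CB.
have A0 : 0 < size A by apply: leq_trans CA.
have small k : k <= size A + size B + 2 -> k < W by move=> *; nia.
pose h := hrun C.
(* The first run of [C] is the last run of [rev C]; the program reads [h] from there. *)
have eh : rl (rev C) (size C) = h by rewrite /rl take_oversize ?size_rev // revK.
have hh : 0 < h < size C.
  rewrite hrun_gt0 // ltn_neqAle hrun_le andbT; apply/eqP => e.
  by move: rC; rewrite size_rle_hrun // -/h e drop_size.
(* [h] is the first boundary after 0 and lies inside [C], so the letters around it differ. *)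
have ne : nth 0 C h != nth 0 C h.-1.
  have := @nextb_bd _ 0 C 0 C0; rewrite /nextb drop0 add0n -/h /bd.
  move: h hh {eh} => h' /andP [h0 hC'].
  by rewrite (gtn_eqF h0) leqNgt hC'.
have hB' : (size B).+2 * (size A).+2 < W by rewrite mulnC.
have b3 := bl 3 isT; have b4 := bl 4 isT; have b5 := bl 5 isT.
have b6 := bl 6 isT; have b7 := bl 7 isT; have b8 := bl 8 isT.
have b9 := bl 9 isT; have b10 := bl 10 isT; have b11 := bl 11 isT.
have b12 := bl 12 isT; have b13 := bl 13 isT; have b14 := bl 14 isT.
have b15 := bl 15 isT; have b16 := bl 16 isT; have b17 := bl 17 isT.
(* The matching tables have at most [(size C).+1] columns, so their addresses fit wherever those of
   the LCS tables do. *)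
have Wh (X : seq nat) k :
    (size X).+2 * (size B).+2 < W \/ (size X).+2 * (size A).+2 < W ->
    k <= size C -> (size X).+2 * k.+2 < W.
  move=> hX hk; have h1 : (size X).+2 * k.+2 <= (size X).+2 * (size B).+2.
    by apply: leq_mul => //; lia.
  have h2 : (size X).+2 * k.+2 <= (size X).+2 * (size A).+2.
    by apply: leq_mul => //; lia.
  by case: hX; lia.
apply: (tri_weaken (Q := fun s' => str_ic_lcs_answer A B C (reg s' 3))).
- apply: tri_seq; first by apply: (@prep_cmd_spec W s A) => //; apply: small; lia.
  move=> s1 /= [hrA hlA hlrA] fr1; carry fr1; clear fr1.
  apply: tri_seq; first by apply: (@prep_cmd_spec W s1 B) => //; apply: small; lia.
  move=> s2 /= [hrB hlB hlrB] fr2; carry fr2; clear fr2.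
  apply: tri_seq; first by apply: (@prep_cmd_spec W s2 C) => //; apply: small; lia.
  move=> s3 /= [hrC hlC hlrC] fr3; carry fr3; clear fr3.
  apply: (tri_seq (Q1 := fun s4 =>
    [/\ reg s4 4 = h, reg s4 5 = h.+1 & reg s4 6 = (size C - h).+1])).
    apply: wp_tri => /=; regs s3.
    rewrite hlrC ?size_rev // eh !addn1.
    by do 5 (split; first by apply: small; lia).
  move=> s4 /= [e4 e5 e6] fr4; carry fr4; clear fr4.
  apply: (tri_seq (Q1 := fun s5 => reg s5 10 = size A /\ reg s5 12 = h.+1)).
    by apply: wp_tri => /=; regs s4.
  move=> s5 /= [e10 e12] fr5; carry fr5; clear fr5.
  apply: tri_seq; first by apply: (@strip_cmd_spec W s5 A C h) => //; [apply: Wh|]; lia.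
  move=> s6 /= t12 fr6; carry fr6; clear fr6.
  apply: (tri_seq (Q1 := fun s7 => reg s7 12 = (size C - h).+1)).
    by apply: wp_tri => /=; regs s6.
  move=> s7 e12' fr7; carry fr7; clear fr7.
  apply: tri_seq.
    apply: (@strip_cmd_spec W s7 (rev A) (rev C) (size C - h));
      rewrite ?size_rev ?revK //; [apply: Wh|]; lia.
  move=> s8 /= t14 fr8; carry fr8; clear fr8.
  apply: (tri_seq (Q1 := fun s9 => reg s9 10 = size B /\ reg s9 12 = h.+1)).
    by apply: wp_tri => /=; regs s8.
  move=> s9 /= [e10' e12''] fr9; carry fr9; clear fr9.
  apply: tri_seq; first by apply: (@strip_cmd_spec W s9 B C h) => //; [apply: Wh|]; lia.
  move=> s10 /= t13 fr10; carry fr10; clear fr10.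
  apply: (tri_seq (Q1 := fun s11 => reg s11 12 = (size C - h).+1)).
    by apply: wp_tri => /=; regs s10.
  move=> s11 /= g12 fr11; carry fr11; clear fr11.
  apply: tri_seq.
    apply: (@strip_cmd_spec W s11 (rev B) (rev C) (size C - h));
      rewrite ?size_rev ?revK //; [apply: Wh|]; lia.
  move=> s12 /= t15 fr12; carry fr12; clear fr12.
  apply: (tri_seq (Q1 := fun s13 =>
    [/\ reg s13 10 = size A, reg s13 12 = size B & reg s13 14 = (size B).+1])).
    by apply: wp_tri => /=; regs s12;
       rewrite addn1; do 2 (split; first by apply: small; lia).
  move=> s13 /= [f10 f12 f14] fr13; carry fr13; clear fr13.
  apply: tri_seq; first by apply: (@lcs_cmd_spec W s13 A B).
  move=> s14 /= t16 fr14; carry fr14; clear fr14.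
  apply: tri_seq.
    by apply: (@lcs_cmd_spec W s14 (rev A) (rev B)); rewrite ?size_rev ?revK.
  move=> s15 /= t17 fr15; carry fr15; clear fr15.
  by apply: (@best_cmd_spec W A B C h) => //; split.
- rewrite !size_rev !size_rle_rev.
  have m0 : 0 < size (rle A) by rewrite size_rle_hrun.
  have n0 : 0 < size (rle B) by rewrite size_rle_hrun.
  have nB := size_rle_le B.
  have [h0 hC'] := andP hh.
  move: h0 hC' CA CB m0 n0 nB; rewrite /=; clear.
  move: (size (rle A)) (size (rle B)) (size A) (size B) (size C) h.
  move=> m n M N c h h0 hc cM cN m0 n0 nN.
  (* As [0 < h < c], both parts of [C] give rows of at most [c] entries, and [c] is at most [M] and
     [N]. [l5] pays for the candidates, [l6] and [l7] for the linear preprocessing. *)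
  have l1 : m * h.+1 <= m * N by rewrite leq_mul2l; lia.
  have l2 : m * (c - h).+1 <= m * N by rewrite leq_mul2l; lia.
  have l3 : n * h.+1 <= n * M by rewrite leq_mul2l; lia.
  have l4 : n * (c - h).+1 <= n * M by rewrite leq_mul2l; lia.
  have l5 : m * n <= m * N by rewrite leq_mul2l nN orbT.
  have l6 : N <= m * N by rewrite leq_pmull.
  have l7 : M <= n * M by rewrite leq_pmull.
  by lia.
by [].
Qed.

End Main.

Theorem theorem3 :
  exists (P : cmd) (c k : nat),
  forall (Sigma : finType) (A B C : seq Sigma) (M N m n : nat),
    size A = M -> size B = N ->
    size (rle A) = m -> size (rle B) = n ->
    0 < size C <= minn M N ->
    1 < size (rle C) ->
  exists (t : nat) (s : state),
    [/\ exec (capacity k (M + N + #|Sigma|)) P (input A B C) t s,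
        t <= c * (m * N + n * M)
      & str_ic_lcs_answer A B C (output s)].
Proof.
exists main_cmd, 4000, 3 => Sigma A B C M N m n <- <- <- <-.
rewrite leq_min => /andP [_ /andP [CA CB]] rC.
have C2 : 1 < size C := leq_trans rC (size_rle_le C).
pose f (x : Sigma) : nat := enum_rank x.
have inj_f : injective f by move=> x y /val_inj/enum_rank_inj.
(* Both lengths are at least 2, because [C] has at least two letters. Hence each factor is at most
   [S], and the product is at most [S ^ 2 < S ^ 3]. *)
have hW : (size A).+2 * (size B).+2 < capacity 3 (size A + size B + #|Sigma|).
  rewrite /capacity; set S := _ + #|_|.
  have [SA SB] : (size A).+2 <= S /\ (size B).+2 <= S by rewrite /S; split; lia.
  have := leq_mul SA SB; rewrite !expnS expn0 muln1; nia.
(* The program works on the letter codes; injectivity of the coding carries the answer back. *)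
have := @main_cmd_spec (capacity 3 (size A + size B + #|Sigma|))
  (code A) (code B) (code C) _ _ _ _ (input A B C).
rewrite !size_map !(size_rle_map _ inj_f).
case=> // [[|[|[|a]]] // _ k|t [s [ex le_t ans]]]; first by rewrite /= !nth_nil.
by exists t, s; split=> //; apply: (str_ic_lcs_answer_map inj_f).
Qed.
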